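(* Assume that - $\hat Q_N=(\hat q_1,\dots,\hat q_N)$ is a non-degenerate normalized central configuration with masses $m=(m_1,\dots,m_N)$; - $x^*\in\mathbb{R}^2$ is a non-degenerate relative normalized central configuration in the restricted $(N+1)$-body problem for $\hat Q_N$ with masses $m$; - $\hat P_k=(\hat p_1,\dots,\hat p_k)$ is a non-degenerate central configuration of the potential $\widetilde W$ induced by $(\hat Q_N,x^* )$ for some positive real numbers $\widetilde\mu=(\widetilde\mu_1,\dots,\widetilde\mu_k)$ with $\sum_i\widetilde\mu_i=1$. Then for all sufficiently small $\Theta>0$ there exists a non-degenerate normalized central configuration $(q_1,\dots,q_N,p_1,\dots,p_k)$ of $N+k$ bodies, with masses $m_i$ (of $q_i$) for $i=1,\dots,N$ and $\mu_j=\Theta\widetilde\mu_j$ (of $p_j$) for $j=1,\dots,k$, such that, as $\Theta\to0$, $$q_i=\hat q_i+\mathcal{O}(\Theta)\quad(i=1,\dots,N),\qquad p_j=x^*+\Theta^{1/3}\hat p_j+\mathcal{O}(\Theta^{2/3})\quad(j=1,\dots,k).$$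
   Context: All masses are positive and all configurations are in the plane with pairwise distinct positions. A normalized central configuration of $n$ bodies with masses $m_1,\dots,m_n$ is a zero $(q_1,\dots,q_n)\in(\mathbb{R}^2)^n$ of the map $F$ with components $$F_i(q_1,\dots,q_n)=q_i-\sum_{j\ne i}\frac{m_j}{|q_i-q_j|^3}(q_i-q_j),\qquad i=1,\dots,n.$$ It is non-degenerate if the rank of $DF(q)$ is $2n-1$ (i.e. $2n-\dim \mathcal{SO}(2)$). For $Q_N=(q_1,\dots,q_N)$ with masses $m_1,\dots,m_N$ put $V_{\rm res}(Q_N,p)=\frac{|p|^2}{2}+\sum_{i=1}^N\frac{m_i}{|p-q_i|}$. A relative normalized central configuration in the restricted $(N+1)$-body problem for $Q_N$ is a point $x^*$ with $\frac{\partial V_{\rm res}}{\partial p}(Q_N,x^* )=0$; it is non-degenerate if $\frac{\partial^2V_{\rm res}}{\partial p^2}(Q_N,x^* )$ is an isomorphism. For fixed $Q_N$ (with its masses), $x\in\mathbb{R}^2$ and positive $\mu=(\mu_1,\dots,\mu_k)$ let $$\widetilde W(x,Q_N,P_k)=\sum_{j=1}^k\frac{\mu_j}{2}\,\frac{\partial^2V_{\rm res}}{\partial p^2}(Q_N,x)(p_j,p_j)+\sum_{1\le i<j\le k}\frac{\mu_i\mu_j}{|p_i-p_j|},\qquad P_k=(p_1,\dots,p_k).$$ A central configuration of the potential $\widetilde W$ induced by $(Q_N,x)$ for $\mu$ is a critical point $P_k$ of $\widetilde W(x,Q_N,\cdot)$, i.e. $\frac{\partial\widetilde W}{\partial p_j}=0$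 for $j=1,\dots,k$. It is called non-degenerate if the Hessian of $\widetilde W(x,Q_N,\cdot)$ with respect to $(p_1,\dots,p_k)\in\mathbb{R}^{2k}$ at $P_k$ is invertible. *)

(* Defs.v *)
From HB Require Import structures.
From mathcomp Require Import all_boot all_order all_algebra.
From mathcomp Require Import all_classical all_reals all_analysis.

Set Implicit Arguments.
Unset Strict Implicit.
Unset Printing Implicit Defensive.

Import Order.TTheory GRing.Theory Num.Theory.
Import numFieldNormedType.Exports.

#[global] Open Scope classical_set_scope.
#[global] Open Scope ring_scope.

(* A configuration of n points of the plane is a matrix Q : 'M[R]_(n, 2) whose
   i-th row is the position of the i-th point; masses are row vectors. *)

(* The norm `|_| that the library puts on 'rV[R]_2 is the sup norm. *)
Definition enorm (R : realType) (v : 'rV[R]_2) : R :=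
  Num.sqrt (\sum_(i < 2) v 0 i ^+ 2).

Definition collision_free (R : realType) (n : nat) (Q : 'M[R]_(n, 2)) : Prop :=
  injective (fun i : 'I_n => row i Q).

Definition critical_point (R : realType) (n d : nat) (f : 'M[R]_(n, d) -> R)
    (x : 'M[R]_(n, d)) : Prop :=
  differentiable f x /\ forall v : 'M[R]_(n, d), 'd f x v = 0.

Definition second_derivative (R : realType) (n d : nat)
    (f : 'M[R]_(n, d) -> R) (x u v : 'M[R]_(n, d)) : R :=
  'd (fun y : 'M[R]_(n, d) => 'd f y u : R) x v.

Definition hessian (R : realType) (n d : nat) (f : 'M[R]_(n, d) -> R)
    (x : 'M[R]_(n, d)) : 'M[R]_(n * d) :=
  \matrix_(a, b) second_derivative f x
                   (vec_mx (delta_mx 0 a)) (vec_mx (delta_mx 0 b)).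

Definition ncc_map (R : realType) (n : nat) (m : 'rV[R]_n)
    (Q : 'M[R]_(n, 2)) : 'M[R]_(n, 2) :=
  \matrix_(i < n)
    (row i Q - \sum_(j < n | j != i)
       (m 0 j / enorm (row i Q - row j Q) ^+ 3) *: (row i Q - row j Q)).

Definition normalized_cc (R : realType) (n : nat) (m : 'rV[R]_n)
    (Q : 'M[R]_(n, 2)) : Prop :=
  collision_free Q /\ ncc_map m Q = 0.

(* rank DF(Q) = 2n - 1, written without truncated subtraction. [lin_mx] is the
   matrix of a linear endomorphism of 'M[R]_(n, 2) ~ R^(2n). *)
Definition nondegenerate_ncc (R : realType) (n : nat) (m : 'rV[R]_n)
    (Q : 'M[R]_(n, 2)) : Prop :=
  normalized_cc m Q /\ (\rank (lin_mx ('d (ncc_map m) Q)) + 1 = 2 * n)%N.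

Definition Vres (R : realType) (N : nat) (m : 'rV[R]_N) (Q : 'M[R]_(N, 2))
    (p : 'rV[R]_2) : R :=
  enorm p ^+ 2 / 2 + \sum_(i < N) m 0 i / enorm (p - row i Q).

Definition relative_ncc (R : realType) (N : nat) (m : 'rV[R]_N)
    (Q : 'M[R]_(N, 2)) (x : 'rV[R]_2) : Prop :=
  (forall i : 'I_N, x <> row i Q) /\ critical_point (Vres m Q) x.

Definition nondegenerate_relative_ncc (R : realType) (N : nat) (m : 'rV[R]_N)
    (Q : 'M[R]_(N, 2)) (x : 'rV[R]_2) : Prop :=
  relative_ncc m Q x /\ hessian (Vres m Q) x \in unitmx.

Definition Wtilde (R : realType) (N k : nat) (m : 'rV[R]_N) (Q : 'M[R]_(N, 2))
    (x : 'rV[R]_2) (mu : 'rV[R]_k) (P : 'M[R]_(k, 2)) : R :=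
  \sum_(j < k) mu 0 j / 2 * second_derivative (Vres m Q) x (row j P) (row j P)
  + \sum_(i < k) \sum_(j < k | (i < j)%N)
      mu 0 i * mu 0 j / enorm (row i P - row j P).

Definition cc_of_Wtilde (R : realType) (N k : nat) (m : 'rV[R]_N)
    (Q : 'M[R]_(N, 2)) (x : 'rV[R]_2) (mu : 'rV[R]_k)
    (P : 'M[R]_(k, 2)) : Prop :=
  collision_free P /\ critical_point (Wtilde m Q x mu) P.

Definition nondegenerate_cc_of_Wtilde (R : realType) (N k : nat) (m : 'rV[R]_N)
    (Q : 'M[R]_(N, 2)) (x : 'rV[R]_2) (mu : 'rV[R]_k)
    (P : 'M[R]_(k, 2)) : Prop :=
  cc_of_Wtilde m Q x mu P /\ hessian (Wtilde m Q x mu) P \in unitmx.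

(* Main.v *)
(* Put e = Theta^(1/3) and look for a solution of the form q_i = qhat_i + e^3 S_i,
   p_j = xstar + e P_j. Divide the equations of the massive bodies by e^3 and
   those of the light bodies by e: as e -> 0 the system decouples into the
   linear equation DF(Qhat) S = g and the critical point equation of Wtilde,
   whose linearizations are DF(Qhat) and, up to the weights, the Hessian of
   Wtilde. The kernel and the defect of DF(Qhat) come from rotations only.
   They are removed by adding lambda(S) J Qhat to the first block of equations,
   where J is the rotation by a right angle and lambda = <J Qhat, .>; as the
   total torque of the forces vanishes identically, lambda is 0 at every
   solution, so that nothing is changed. A Newton iteration with frozen
   derivative solves the modified system at distance O(e) from its limiting
   solution. There the modified derivative is still invertible; being a rank one
   correction of DF, it gives corank at most 1, and the rotational direction
   gives corank at least 1. *)

Require Import Defs.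
From HB Require Import structures.
From mathcomp Require Import all_boot all_order all_algebra.
From mathcomp Require Import all_classical all_reals all_analysis.
From mathcomp Require Import ring lra.
Import Order.TTheory GRing.Theory Num.Theory.
Import numFieldNormedType.Exports.

Set Implicit Arguments.
Unset Strict Implicit.
Unset Printing Implicit Defensive.

Local Open Scope classical_set_scope.
Local Open Scope ring_scope.

(** * Linearization of a family of maps as its parameter tends to 0 *)

(** The scale e = Theta^(1/3) balances the forces on a light body. The residual of its equation at
    distance e from [xstar] has order e, since [xstar] is critical for [Vres]; the mutual attraction
    of light bodies has order Theta / e^2. Both agree when Theta = e^3. Undoing the scaling gives
    the error terms of the theorem: e times an error O(e) for light bodies, e^3 times a bounded
    displacement for massive ones. The obstacle is the limit e = 0: all light bodies collide at
    [xstar], the divisions by e and e^3 lose their meaning, and the rescaled family is given only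
    for e > 0. An implicit function theorem would ask for an extension differentiable at e = 0.
    Instead, [udiff] records Lipschitz estimates uniform in e. They pass through sums, products,
    compositions and difference quotients, so the whole family is handled by assembling it from the
    Newtonian kernel. They make the iteration contract, and they also compare the exact derivative
    at the solution with the limiting linear map, which transfers injectivity from the latter to the
    former. *)

Definition udiff_bound (R : realType) (V W : normedModType R) (C d : R)
    (H : R -> V -> W) (a : V) (c : W) (L : V -> W) : Prop :=
  [/\ forall h, `|L h| <= C * `|h|,
      forall e : R, 0 < e <= d -> `|H e a - c| <= C * e
    & forall (e : R) u v, 0 < e <= d -> `|u - a| <= d -> `|v - a| <= d ->
        `|H e u - H e v - L (u - v)|
          <= C * (e + `|u - a| + `|v - a|) * `|u - v| ].

(* As e -> 0+, H e a = c + O(e), and H e - L has Lipschitz constant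
   O(e + distance to a) near a. No regularity in e is required, and H e need not
   make sense for e = 0. *)
Definition udiff (R : realType) (V W : normedModType R)
    (H : R -> V -> W) (a : V) (c : W) (L : V -> W) : Prop :=
  linear L /\ exists C d : R, [/\ 0 < C, 0 < d, d <= 1 & udiff_bound C d H a c L].

(** For a constant family, e can be sent to 0 in the third clause. What remains is strict
    differentiability at a with a Lipschitz rate, an estimate between any two points near a. *)
Definition sdiff (R : realType) (V W : normedModType R)
    (f : V -> W) (a : V) (L : V -> W) : Prop :=
  udiff (fun=> f) a (f a) L.

Lemma udiff_bound_le (R : realType) (V W : normedModType R) (C d C' d' : R)
    (H : R -> V -> W) a c L :
  C <= C' -> d' <= d -> udiff_bound C d H a c L -> udiff_bound C' d' H a c L.
Proof.
move=> CC dd [b1 b2 b3]; split.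
- by move=> h; apply: le_trans (b1 h) _; rewrite ler_wpM2r.
- move=> e /andP[e0 ed]; apply: le_trans (b2 e _) _.
    by rewrite e0 (le_trans ed).
  by rewrite ler_wpM2r// ltW.
- move=> e u v /andP[e0 ed] ua va; apply: le_trans (b3 e u v _ _ _) _.
  + by rewrite e0 (le_trans ed).
  + exact: le_trans dd.
  + exact: le_trans dd.
  + by rewrite !ler_wpM2r// !addr_ge0// ltW.
Qed.

(** The factor 4 is 3 + 1: the remainder contributes at most 3 d C <= 3 C times the increment, the
    linear part C. The factor 8 of the next lemma comes from e and the distance to a, each at most d
    <= 1. *)
Lemma lip_constant_le (R : realType) (C d s : R) :
  0 < C -> d <= 1 -> s <= d + d + d -> C * s + C <= 4 * C.
Proof. nra. Qed.

Lemma size_constant_le (R : realType) (C d s : R) :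
  0 < C -> d <= 1 -> s <= d + d -> 4 * C * s <= 8 * C.
Proof. nra. Qed.

Section bound_consequences.
Variables (R : realType) (V W : normedModType R) (C d : R).
Variables (H : R -> V -> W) (a : V) (c : W) (L : V -> W).
Hypotheses (C0 : 0 < C) (d0 : 0 < d) (d1 : d <= 1).
Hypothesis HL : udiff_bound C d H a c L.

Lemma udiff_bound_lip (e : R) u v : 0 < e <= d -> `|u - a| <= d -> `|v - a| <= d ->
  `|H e u - H e v| <= 4 * C * `|u - v|.
Proof.
case: HL => b1 _ b3 ed ua va; have := b3 e u v ed ua va.
have := b1 (u - v); case/andP: ed => e0 ed h1 h2.
have -> : H e u - H e v = (H e u - H e v - L (u - v)) + L (u - v) by rewrite subrK.
apply: le_trans (ler_normD _ _) _.
apply: le_trans (lerD h2 h1) _.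
rewrite -mulrDl ler_wpM2r//.
by rewrite (lip_constant_le C0 d1)// !lerD.
Qed.

Lemma udiff_bound_val (e : R) u : 0 < e <= d -> `|u - a| <= d ->
  `|H e u - c| <= 4 * C * (e + `|u - a|).
Proof.
move=> ed ua; have aa : `|a - a| <= d by rewrite subrr normr0 ltW.
have h1 := udiff_bound_lip ed ua aa.
case: HL => _ /(_ e ed) h2 _.
have -> : H e u - c = (H e u - H e a) + (H e a - c) by rewrite addrA subrK.
apply: le_trans (ler_normD _ _) _; apply: le_trans (lerD h1 h2) _.
rewrite mulrDr addrC lerD2r ler_wpM2r//; first by case/andP: ed => /ltW.
by rewrite ler_peMl ?ltW// ltr1n.
Qed.

Lemma udiff_bound_size (e : R) u : 0 < e <= d -> `|u - a| <= d ->
  `|H e u| <= `|c| + 8 * C.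
Proof.
move=> ed ua; have h := udiff_bound_val ed ua.
have -> : H e u = c + (H e u - c) by rewrite addrC subrK.
apply: le_trans (ler_normD _ _) _; rewrite lerD2l; apply: le_trans h _.
by case/andP: ed => e0 ed; rewrite (size_constant_le C0 d1)// lerD.
Qed.

End bound_consequences.

Lemma sub2rACA (V : zmodType) (x y z x' y' z' : V) :
  x + x' - (y + y') - (z + z') = (x - y - z) + (x' - y' - z').
Proof. by rewrite (opprD y) (opprD z) (addrACA x) (addrACA (x - y)). Qed.

Section linear_functions.
Variables (R : realType) (V W : lmodType R) (L : V -> W).
Hypothesis Ll : linear L.

(** In [udiff] the linear part is a bare function, so that the closure lemmas can give it as an
    explicit expression; packing it recovers the algebra of linear maps. *)
Let Lm : {linear V -> W} := HB.pack L (GRing.isLinear.Build R V W *:%R L Ll).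

Lemma linear_funD u v : L (u + v) = L u + L v. Proof. exact: (linearD Lm). Qed.
Lemma linear_funB u v : L (u - v) = L u - L v. Proof. exact: (linearB Lm). Qed.
Lemma linear_funZ k u : L (k *: u) = k *: L u. Proof. exact: (linearZ_LR Lm). Qed.
Lemma linear_funN u : L (- u) = - L u. Proof. exact: (linearN Lm). Qed.
Lemma linear_fun0 : L 0 = 0. Proof. exact: (linear0 Lm). Qed.

End linear_functions.

Lemma linear_cst0 (R : realType) (V W : normedModType R) :
  linear (fun _ : V => 0 : W).
Proof. by move=> k x y; rewrite scaler0 addr0. Qed.

Lemma udiff_ext (R : realType) (V W : normedModType R)
    (H H' : R -> V -> W) a c c' L L' :
  (exists2 r : R, 0 < r & forall (e : R) u, 0 < e <= r -> `|u - a| <= r ->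
     H e u = H' e u) ->
  c = c' -> (forall h, L h = L' h) -> udiff H a c L -> udiff H' a c' L'.
Proof.
move=> [r r0 HH] -> /funext -> [Ll [C [d [C0 d0 d1 b]]]]; split=> //.
exists C, (Num.min d r); split=> //.
- by rewrite lt_min d0.
- by rewrite ge_min d1.
have [|b1 b2 b3] := @udiff_bound_le _ _ _ _ _ C (Num.min d r) _ _ _ _ (lexx _) _ b.
  by rewrite ge_min lexx.
have rr : forall x, x <= Num.min d r -> x <= r by move=> x; rewrite le_min => /andP[].
split=> //.
- move=> e /[dup] ed /b2; rewrite HH//; last by rewrite subrr normr0 ltW.
  by case/andP: ed => -> /rr.
- move=> e u v /[dup] ed /andP[e0 /rr er] ua va.
  by rewrite -!HH ?e0 ?er ?rr//; exact: b3.
Qed.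

Lemma udiff_eq (R : realType) (V W : normedModType R)
    (H H' : R -> V -> W) a c c' L L' :
  (forall (e : R) u, 0 < e -> H e u = H' e u) ->
  c = c' -> (forall h, L h = L' h) -> udiff H a c L -> udiff H' a c' L'.
Proof.
move=> HH; apply: udiff_ext; exists 1 => // e u /andP[e0 _] _; exact: HH.
Qed.

(** * Closure of linearizability under algebraic operations, composition and rescaling *)

Section closure.
Variables (R : realType) (V W : normedModType R).
Implicit Types (H G : R -> V -> W) (a : V) (c : W) (L M : V -> W).

Lemma udiff_linear L a (C : R) : linear L -> (forall h, `|L h| <= C * `|h|) ->
  udiff (fun=> L) a (L a) L.
Proof.
move=> Ll LC; split=> //; exists (Num.max C 1), 1.
have C1 : 0 < Num.max C 1 by rewrite lt_max ltr01 orbT.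
split=> //; split.
- move=> h; apply: le_trans (LC h) _; rewrite ler_wpM2r// le_max lexx//.
- by move=> e /andP[e0 _]; rewrite subrr normr0 mulr_ge0 ?ltW.
- move=> e u v /andP[e0 _] _ _.
  by rewrite (linear_funB Ll) subrr normr0 !mulr_ge0// ?addr_ge0// ltW.
Qed.

Lemma udiff_cst a c : udiff (fun _ _ => c) a c (fun=> 0).
Proof.
split; first exact: linear_cst0.
exists 1, 1; split=> //; split.
- by move=> h; rewrite normr0 mulr_ge0.
- by move=> e /andP[e0 _]; rewrite subrr normr0 mulr_ge0// ltW.
- move=> e u v /andP[e0 _] _ _.
  by rewrite !subrr normr0 !mulr_ge0// ?addr_ge0// ltW.
Qed.

Lemma udiffD H G a c c' L M : udiff H a c L -> udiff G a c' M ->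
  udiff (fun e u => H e u + G e u) a (c + c') (fun h => L h + M h).
Proof.
move=> [Ll [C [d [C0 d0 d1 b]]]] [Ml [C' [d' [C'0 d'0 d'1 b']]]]; split.
  by move=> k x y; rewrite Ll Ml scalerDr addrACA.
exists (C + C'), (Num.min d d'); split.
- exact: addr_gt0.
- by rewrite lt_min d0.
- by rewrite ge_min d1.
have [||b1 b2 b3] := @udiff_bound_le _ _ _ _ _ C (Num.min d d') _ _ _ _ _ _ b => //.
  by rewrite ge_min lexx.
have [||b1' b2' b3'] := @udiff_bound_le _ _ _ _ _ C' (Num.min d d') _ _ _ _ _ _ b' => //.
  by rewrite ge_min lexx orbT.
split.
- by move=> h; apply: le_trans (ler_normD _ _) _; rewrite mulrDl lerD.
- move=> e ed; rewrite opprD addrACA; apply: le_trans (ler_normD _ _) _.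
  by rewrite mulrDl lerD ?b2 ?b2'.
- move=> e u v ed ua va; rewrite sub2rACA.
  by apply: le_trans (ler_normD _ _) _; rewrite mulrDl mulrDl lerD ?b3 ?b3'.
Qed.

Lemma udiffZ (k : R) H a c L : udiff H a c L ->
  udiff (fun e u => k *: H e u) a (k *: c) (fun h => k *: L h).
Proof.
move=> [Ll [C [d [C0 d0 d1 [b1 b2 b3]]]]]; split.
  by move=> l x y; rewrite Ll scalerDr !scalerA mulrC.
have kC : `|k| * C <= (`|k| + 1) * C by rewrite ler_wpM2r ?ltW// ltrDl.
exists ((`|k| + 1) * C), d; split=> //.
  by rewrite mulr_gt0// ltr_wpDl.
apply: udiff_bound_le kC (lexx d) _; split.
- by move=> h; rewrite normrZ -mulrA ler_wpM2l.
- by move=> e ed; rewrite -scalerBr normrZ -mulrA ler_wpM2l// b2.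
- move=> e u v ed ua va; rewrite -!scalerBr normrZ -!mulrA ler_wpM2l// mulrA.
  exact: b3.
Qed.

Lemma udiffN H a c L : udiff H a c L ->
  udiff (fun e u => - H e u) a (- c) (fun h => - L h).
Proof.
by move=> h; apply: udiff_eq (udiffZ (-1) h) => * /=; rewrite scaleN1r.
Qed.

Lemma udiffB H G a c c' L M : udiff H a c L -> udiff G a c' M ->
  udiff (fun e u => H e u - G e u) a (c - c') (fun h => L h - M h).
Proof. by move=> h /udiffN; exact: udiffD. Qed.

Lemma udiff_sum (I : Type) (r : seq I) (P : pred I) (H : I -> R -> V -> W) a
    (c : I -> W) (L : I -> V -> W) :
  (forall i, P i -> udiff (H i) a (c i) (L i)) ->
  udiff (fun e u => \sum_(i <- r | P i) H i e u) a
        (\sum_(i <- r | P i) c i) (fun h => \sum_(i <- r | P i) L i h).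
Proof.
move=> HL; elim: r => [|i r IH].
  apply: udiff_eq (udiff_cst a 0); rewrite ?big_nil//.
    by move=> *; rewrite big_nil.
  by move=> h; rewrite big_nil.
have [Pi|Pi] := boolP (P i); last first.
  apply: udiff_eq IH => [e u _||h]; by rewrite big_cons (negbTE Pi).
apply: udiff_eq (udiffD (HL _ Pi) IH) => [e u _||h]; by rewrite big_cons Pi.
Qed.

(** A family that is bounded and Lipschitz near a, uniformly in e, becomes O(e) in both senses after
    multiplication by e. This is how the coupling between the two blocks disappears in the limit. *)
Lemma udiff_mule H a c L : udiff H a c L ->
  udiff (fun e u => e *: H e u) a 0 (fun=> 0).
Proof.
move=> [Ll [C [d [C0 d0 d1 b]]]]; split; first exact: linear_cst0.
pose B := `|c| + 8 * C; have B0 : 0 < B by rewrite ltr_wpDl// mulr_gt0.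
have CB : 4 * C <= B by rewrite (@le_trans _ _ (8 * C))// ?ler_pM2r// ?ler_nat// lerDr.
exists B, d; split=> //; split.
- by move=> h; rewrite normr0 mulr_ge0// ltW.
- move=> e /[dup] /andP[e0 _] ed; rewrite subr0 normrZ gtr0_norm// mulrC ler_wpM2r ?(ltW e0)//.
  by apply: (udiff_bound_size C0 d0 d1 b) => //; rewrite subrr normr0 ltW.
- move=> e u v /[dup] /andP[e0 _] ed ua va.
  rewrite subr0 -scalerBr normrZ gtr0_norm//.
  have := udiff_bound_lip C0 d1 b ed ua va => h.
  apply: le_trans (ler_wpM2l (ltW e0) h) _.
  rewrite mulrA ler_wpM2r// mulrC ler_pM ?(ltW e0)//.
    by rewrite mulr_ge0// ltW.
  by rewrite -addrA lerDl addr_ge0.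
Qed.

End closure.

Lemma udiff_bound2 (R : realType) (V W V' W' : normedModType R)
    (H : R -> V -> W) (G : R -> V' -> W') a c L a' c' L' :
  udiff H a c L -> udiff G a' c' L' ->
  exists C d : R, [/\ 0 < C, 0 < d, d <= 1,
    udiff_bound C d H a c L & udiff_bound C d G a' c' L'].
Proof.
move=> [_ [C [d [C0 d0 d1 b]]]] [_ [C' [d' [C'0 d'0 d'1 b']]]].
exists (Num.max C C'), (Num.min d d'); split.
- by rewrite lt_max C0.
- by rewrite lt_min d0.
- by rewrite ge_min d1.
- by apply: udiff_bound_le b; rewrite ?le_max ?ge_min lexx.
- by apply: udiff_bound_le b'; rewrite ?le_max ?ge_min lexx orbT.
Qed.

(** The remainder of the product rule: p, q are the values of the scalar factor at two points, x, y
    those of the vector factor, c, c' the limits and l, m the linear parts of the increments. Each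
    of the four terms is second order. *)
Lemma scale_split (R : realType) (W : lmodType R) (p q l c : R) (x y m c' : W) :
  p *: x - q *: y - (l *: c' + c *: m) =
  ((p - q - l) *: x + l *: (x - c')) + (q *: (x - y - m) + (q - c) *: m).
Proof.
rewrite [(_ - l) *: x]scalerBl [l *: (x - c')]scalerBr [X in _ = X + _]addrA subrK.
rewrite [q *: (_ - m)]scalerBr [(q - c) *: m]scalerBl [X in _ = _ + X]addrA subrK.
by rewrite [RHS]addrACA scalerBl [q *: (_ - _)]scalerBr [X in _ = X + _]addrA subrK opprD.
Qed.

Lemma udiff_scale (R : realType) (V W : normedModType R)
    (H : R -> V -> R) (G : R -> V -> W) a (c : R) c' L M :
  udiff H a c L -> udiff G a c' M ->
  udiff (fun e u => H e u *: G e u) a (c *: c')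
        (fun h => L h *: c' + c *: M h).
Proof.
move=> HH GG; have [C [d [C0 d0 d1 b b']]] := udiff_bound2 HH GG.
have [Ll _] := HH; have [Ml _] := GG; split.
  move=> k x y; rewrite Ll Ml scalerDl !scalerDr !scalerA.
  by rewrite [c * k]mulrC addrACA.
(* By [udiff_bound_size], K bounds both factors near a; it also dominates 4 C. Each term of
   [scale_split] is then at most C K times (e + distances) times the increment, hence the constant 4
   C K. *)
pose K : R := `|c| + `|c'| + 8 * C.
have K0 : 0 < K by rewrite ltr_wpDl ?addr_ge0// mulr_gt0.
have cK : `|c| + 8 * C <= K by rewrite lerD2r lerDl.
have c'K : `|c'| + 8 * C <= K by rewrite lerD2r lerDr.
have CK : 4 * C <= K by rewrite (@le_trans _ _ (8 * C))// ?ler_pM2r// ?ler_nat// lerDr addr_ge0.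
have cK' : `|c| <= K by rewrite (le_trans _ cK)// lerDl mulr_ge0// ltW.
have c'K' : `|c'| <= K by rewrite (le_trans _ c'K)// lerDl mulr_ge0// ltW.
exists (4 * C * K), d; split=> //.
  by rewrite !mulr_gt0.
have [b1 b2 b3] := b; have [b1' b2' b3'] := b'.
have aa : `|a - a| <= d by rewrite subrr normr0 ltW.
have K2 (x : R) : 0 <= x -> C * x * K + K * (C * x) <= 4 * C * K * x.
  move=> x0; have -> : C * x * K + K * (C * x) = 2 * C * K * x by ring.
  by rewrite !ler_wpM2r ?(ltW K0) ?(ltW C0)// ler_nat.
split.
- move=> h; apply: le_trans (ler_normD _ _) _; rewrite !normrZ.
  apply: le_trans (K2 _ (normr_ge0 h)); apply: lerD; apply: ler_pM => //.
- move=> e ed; have e0 : 0 <= e by case/andP: ed => /ltW.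
  have -> : H e a *: G e a - c *: c' = (H e a - c) *: G e a + c *: (G e a - c').
    by rewrite scalerBl scalerBr addrA subrK.
  apply: le_trans (ler_normD _ _) _; rewrite !normrZ.
  apply: le_trans (K2 _ e0); apply: lerD; apply: ler_pM => //; last exact: b2'.
    exact: b2.
  by apply: le_trans c'K; apply: udiff_bound_size b' _ _ ed aa.
- move=> e u v ed ua va; rewrite scale_split.
  have e0 : 0 <= e by case/andP: ed => /ltW.
  set s := e + _ + _; set r := `|u - v|.
  have su : e + `|u - a| <= s by rewrite /s lerDl.
  have sv : e + `|v - a| <= s by rewrite /s addrAC lerDl.
  have s0 : 0 <= s by rewrite !addr_ge0.
  have r0 : 0 <= r := normr_ge0 _.
  have -> : 4 * C * K * s * r = (C * s * r * K + C * r * (K * s)) + (K * (C * s * r) + K * s * (C * r)) by ring.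
  have G4 : `|G e u - c'| <= K * s.
    apply: (le_trans (udiff_bound_val C0 d0 d1 b' ed ua)).
    by rewrite ler_pM// ?addr_ge0// mulr_ge0// ltW.
  have H4 : `|H e v - c| <= K * s.
    apply: (le_trans (udiff_bound_val C0 d0 d1 b ed va)).
    by rewrite ler_pM// ?addr_ge0// mulr_ge0// ltW.
  have Gs : `|G e u| <= K by apply: le_trans c'K; apply: (udiff_bound_size C0 d0 d1 b' ed ua).
  have Hs : `|H e v| <= K by apply: le_trans cK; apply: (udiff_bound_size C0 d0 d1 b ed va).
  have h1 := b3 _ _ _ ed ua va; have h2 := b3' _ _ _ ed ua va.
  apply: le_trans (ler_normD _ _) _; apply: lerD;
   (apply: le_trans (ler_normD _ _) _; apply: lerD; rewrite normrZ; apply: ler_pM => //; exact: b1 || exact: b1').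
Qed.

Lemma udiff_comp (R : realType) (V W X : normedModType R)
    (F : R -> W -> X) (G : R -> V -> W) a b c L M :
  udiff F b c M -> udiff G a b L ->
  udiff (fun e u => F e (G e u)) a c (fun h => M (L h)).
Proof.
move=> FF GG; have [C [d [C0 d0 d1 B B']]] := udiff_bound2 FF GG.
have [Ml _] := FF; have [Ll _] := GG; split; first by move=> k x y; rewrite Ll Ml.
(* K absorbs two value estimates 4 C (e + distance): on the radius d / K the inner map stays within
   d of b, and e plus the two distances to b is at most K times the same sum taken at a. *)
pose K : R := 1 + 8 * C; have K0 : 0 < K by rewrite ltr_wpDr// mulr_ge0// ltW.
have K1 : 1 <= K by rewrite lerDl mulr_ge0// ltW.
pose d' : R := d / K; have d'0 : 0 < d' by rewrite divr_gt0.
have d'd : d' <= d by rewrite ler_pdivrMr// ler_peMr// ltW.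
have Kd' : K * d' = d by rewrite mulrC divfK// gt_eqF.
have [b1 b2 b3] := B; have [b1' b2' b3'] := udiff_bound_le (lexx C) d'd B'.
have GK (e : R) u : 0 < e <= d' -> `|u - a| <= d' -> `|G e u - b| <= 4 * C * (e + `|u - a|).
  move=> ed ua; apply: (udiff_bound_val C0 d0 d1 B') (le_trans ua d'd).
  by case/andP: ed => -> /le_trans ->.
have Gd (e : R) u : 0 < e <= d' -> `|u - a| <= d' -> `|G e u - b| <= d.
  move=> ed ua; apply: le_trans (GK _ _ ed ua) _.
  apply: (@le_trans _ _ (4 * C * (d' + d'))).
    by rewrite ler_wpM2l ?mulr_ge0// ?(ltW C0)// lerD//; case/andP: ed.
  rewrite -Kd' /K; clear -C0 d'0; nra.
have ee (e : R) : 0 < e <= d' -> 0 < e <= d.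
  by case/andP => -> /le_trans ->.
exists (4 * C * C * K + C * C + 4 * C * (1 + C)), d'; split=> //.
- by rewrite !addr_gt0 ?mulr_gt0// addr_gt0.
- exact: le_trans d1.
have CC : 0 <= 4 * C * C * K by rewrite !mulr_ge0// ltW.
have CC1 : 0 <= 4 * C * (1 + C) by rewrite !mulr_ge0 ?addr_ge0// ltW.
split.
- move=> h; apply: le_trans (b1 _) _.
  apply: (@le_trans _ _ (C * C * `|h|)); first by rewrite -mulrA ler_wpM2l ?(ltW C0).
  by rewrite ler_wpM2r// addrAC lerDr addr_ge0.
- move=> e ed; have aa : `|a - a| <= d' by rewrite subrr normr0 ltW.
  have e0 : 0 <= e by case/andP: ed => /ltW.
  apply: le_trans (udiff_bound_val C0 d0 d1 B (ee _ ed) (Gd _ _ ed aa)) _.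
  apply: (@le_trans _ _ (4 * C * (e + C * e))).
    by rewrite ler_wpM2l ?mulr_ge0// ?(ltW C0)// lerD2l b2'.
  rewrite -{1}[e]mul1r -mulrDl mulrA ler_wpM2r// lerDr.
  by rewrite addr_ge0// mulr_ge0// ltW.
- move=> e u v ed ua va.
  have e0 : 0 <= e by case/andP: ed => /ltW.
  have h1 := b3 _ _ _ (ee _ ed) (Gd _ _ ed ua) (Gd _ _ ed va).
  have h2 : `|M (G e u - G e v - L (u - v))| <=
      C * (C * (e + `|u - a| + `|v - a|) * `|u - v|).
    by apply: le_trans (b1 _) _; rewrite ler_wpM2l ?(ltW C0)// b3'.
  have h3 : `|G e u - G e v| <= 4 * C * `|u - v|.
    apply: (udiff_bound_lip C0 d1 B' (ee _ ed)); exact: le_trans d'd.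
  rewrite (linear_funB Ml) in h2.
  rewrite -[F e (G e u) - _ - _](subrKA (M (G e u - G e v))).
  apply: le_trans (ler_normD _ _) _; apply: le_trans (lerD h1 h2) _.
  set s := e + `|u - a| + `|v - a|; set r := `|u - v|.
  have s0 : 0 <= s by rewrite !addr_ge0.
  have r0 : 0 <= r := normr_ge0 _.
  apply: (@le_trans _ _ (C * (K * s) * (4 * C * r) + C * (C * s * r))); last first.
    have -> : C * (K * s) * (4 * C * r) + C * (C * s * r) =
       (4 * C * C * K + C * C) * s * r by ring.
    by rewrite !ler_wpM2r// lerDl.
  rewrite lerD2r ler_pM//; first by rewrite mulr_ge0 ?(ltW C0) ?addr_ge0.
  rewrite ler_wpM2l ?(ltW C0)//.
  apply: le_trans (lerD (lerD (lexx e) (GK _ _ ed ua)) (GK _ _ ed va)) _.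
  have aux (x y : R) : 0 <= x -> 0 <= y ->
      e + 4 * C * (e + x) + 4 * C * (e + y) <= K * (e + x + y).
    by move=> x0 y0; rewrite /K; clear -C0 e0 x0 y0; nra.
  exact: aux.
Qed.

(* Used with rho e = e^3 for the mutual attraction of the massive bodies and
   rho e = e for the attraction of a light body by a massive one. *)
Lemma udiff_rescale (R : realType) (V W X : normedModType R) (f : W -> X) b L
    (rho : R -> R) (sigma : R -> V -> W) (sigma0 : V -> W) (S : R) a :
  sdiff f b L ->
  (forall e : R, 0 < e <= 1 -> 0 < rho e <= e) ->
  (forall e, linear (sigma e)) -> linear sigma0 ->
  (forall h, `|sigma0 h| <= S * `|h|) ->
  (forall (e : R) h, 0 < e <= 1 -> `|sigma e h - sigma0 h| <= S * e * `|h|) ->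
  udiff (fun e u => (rho e)^-1 *: (f (b + rho e *: sigma e u) - f b)) a
        (L (sigma0 a)) (fun h => L (sigma0 h)).
Proof.
move=> [Ll [C [d [C0 d0 d1 [b1 _ b3]]]]] rhoe sl s0l s0S sS.
wlog S0 : S s0S sS / 0 < S => [hw|].
  apply: (hw (Num.max S 1)); last by rewrite lt_max ltr01 orbT.
    by move=> h; apply: le_trans (s0S h) _; rewrite ler_wpM2r// le_max lexx.
  move=> e h e01; apply: le_trans (sS e h e01) _.
  by rewrite !ler_wpM2r ?le_max ?lexx//; case/andP: e01 => /ltW.
split; first by move=> k x y; rewrite s0l Ll.
pose A : R := `|a| + 1.
have A1 : 1 <= A by rewrite lerDr.
have A0 : 0 < A by rewrite (lt_le_trans _ A1).
(* On this ball |u| <= A and |sigma e u| <= 2 S A, so the argument of f moves by at most 2 S A e and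
   stays within d of b. *)
pose d' : R := d / (1 + 2 * S * A).
have D0 : 0 < 1 + 2 * S * A by rewrite addr_gt0 ?mulr_gt0.
have d'0 : 0 < d' by rewrite divr_gt0.
have d'd : d' <= d by rewrite ler_pdivrMr// ler_peMr ?(ltW d0)// lerDl !mulr_ge0// ltW.
have d'1 := le_trans d'd d1.
have d'E : d' * (1 + 2 * S * A) = d by rewrite divfK// gt_eqF.
have e1 (e : R) : 0 < e <= d' -> 0 < e <= 1 by case/andP=> -> /le_trans ->.
have eD (e : R) : 0 < e <= d' -> 0 < e <= d by case/andP=> -> /le_trans ->.
have s2 (e : R) h : 0 < e <= 1 -> `|sigma e h| <= 2 * S * `|h|.
  move=> e01; rewrite -[sigma e h](subrK (sigma0 h)).
  apply: le_trans (ler_normD _ _) _; apply: le_trans (lerD (sS _ _ e01) (s0S _)) _.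
  rewrite -mulrDl ler_wpM2r// mulr_natl mulr2n lerD2r ler_piMr ?(ltW S0)//.
  by case/andP: e01.
have uA u : `|u - a| <= d' -> `|u| <= A.
  move=> ua; rewrite -[u](subrK a) addrC; apply: le_trans (ler_normD _ _) _.
  by rewrite lerD2l (le_trans ua).
have rs (e : R) u : 0 < e <= d' -> `|u - a| <= d' ->
    `|b + rho e *: sigma e u - b| <= e * (2 * S * A).
  move=> ed ua; rewrite addrC addKr normrZ.
  have /andP[r0 re] := rhoe _ (e1 _ ed).
  rewrite gtr0_norm// ler_pM ?(ltW r0)//; apply: le_trans (s2 _ _ (e1 _ ed)) _.
  by rewrite ler_wpM2l ?uA// mulr_ge0// ltW.
have rsd (e : R) u : 0 < e <= d' -> `|u - a| <= d' ->
    `|b + rho e *: sigma e u - b| <= d.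
  move=> ed ua; apply: le_trans (rs _ _ ed ua) _; rewrite -d'E ler_pM//.
  - by case/andP: ed => /ltW.
  - by rewrite !mulr_ge0// ltW.
  - by case/andP: ed.
  - by rewrite lerDr.
have aa : `|a - a| <= d' by rewrite subrr normr0 ltW.
(* The division by [rho e] is harmless because the increment of the argument carries the same
   factor. The case w = b, h = a gives the value clause; w the image of v, h = u - v gives the
   Lipschitz clause. *)
have key (e : R) x w h : 0 < e <= d' -> `|b + rho e *: sigma e x - b| <= d ->
    `|w - b| <= d -> b + rho e *: sigma e x - w = rho e *: sigma e h ->
    `|(rho e)^-1 *: (f (b + rho e *: sigma e x) - f w) - L (sigma0 h)| <=
    (C * (e + `|b + rho e *: sigma e x - b| + `|w - b|) * (2 * S)
     + C * S * e) * `|h|.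
  move=> ed xb wb E; have := b3 _ _ _ (eD _ ed) xb wb; rewrite E => h1.
  have /andP[r0 re] := rhoe _ (e1 _ ed).
  have h2 : `|L (sigma e h - sigma0 h)| <= C * (S * e * `|h|).
    by apply: le_trans (b1 _) _; rewrite ler_wpM2l ?(ltW C0)// sS// e1.
  have -> : (rho e)^-1 *: (f (b + rho e *: sigma e x) - f w) - L (sigma0 h) =
     (rho e)^-1 *: (f (b + rho e *: sigma e x) - f w - L (rho e *: sigma e h))
     + L (sigma e h - sigma0 h).
    rewrite (linear_funZ Ll) (linear_funB Ll) [X in _ = X + _]scalerBr scalerA.
    by rewrite mulVf ?gt_eqF// scale1r subrKA.
  apply: le_trans (ler_normD _ _) _; rewrite mulrDl lerD//; last by rewrite -!mulrA in h2 *.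
  rewrite normrZ normfV gtr0_norm// mulrC ler_pdivrMr//; apply: le_trans h1 _.
  rewrite normrZ gtr0_norm// -[X in _ <= X]mulrA -[X in _ <= X]mulrA ler_wpM2l//.
    by rewrite mulr_ge0 ?(ltW C0)// !addr_ge0//; case/andP: ed => /ltW.
  by rewrite mulrA [X in _ <= X]mulrC ler_wpM2l ?(ltW r0)// s2// e1.
pose B : R := (C * (1 + 4 * S * A) * (2 * S) + C * S) * A.
have B1 : 0 < C * (1 + 4 * S * A) * (2 * S) + C * S.
  by rewrite !addr_gt0 ?mulr_gt0// addr_gt0 ?mulr_gt0.
have B0 : 0 < B by rewrite mulr_gt0.
have bb (e : R) x w h : 0 < e <= d' -> `|b + rho e *: sigma e x - b| <= e * (2 * S * A) ->
    `|w - b| <= e * (2 * S * A) ->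
    (C * (e + `|b + rho e *: sigma e x - b| + `|w - b|) * (2 * S)
     + C * S * e) * `|h| <= (C * (1 + 4 * S * A) * (2 * S) + C * S) * e * `|h :> V|.
  move=> ed xb wb; rewrite ler_wpM2r// [X in _ <= X]mulrDl lerD2r.
  rewrite [X in _ <= X]mulrAC ler_wpM2r// ?mulr_ge0// ?(ltW S0)//.
  rewrite -[X in _ <= X]mulrA ler_wpM2l ?(ltW C0)//.
  apply: le_trans (lerD (lerD (lexx e) xb) wb) _.
  by rewrite le_eqVlt; apply/orP; left; apply/eqP; ring.
exists B, d'; split=> //; split.
- move=> h; apply: le_trans (b1 _) _.
  apply: (@le_trans _ _ (C * S * `|h|)); first by rewrite -mulrA ler_wpM2l ?(ltW C0).
  rewrite ler_wpM2r//; apply: (@le_trans _ _ (C * (1 + 4 * S * A) * (2 * S) + C * S)).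
    by rewrite lerDr !mulr_ge0 ?addr_ge0 ?mulr_ge0// ltW.
  by rewrite ler_peMr// ltW.
- move=> e ed; have b0 : `|b - b| <= e * (2 * S * A).
    by rewrite subrr normr0 !mulr_ge0//; try (by case/andP: ed => /ltW); rewrite ltW.
  have bd : `|b - b| <= d by rewrite subrr normr0 ltW.
  have E : b + rho e *: sigma e a - b = rho e *: sigma e a by rewrite addrC addKr.
  apply: le_trans (key e a b a ed (rsd _ _ ed aa) bd E) _.
  apply: le_trans (bb e a b a ed (rs _ _ ed aa) b0) _.
  rewrite /B [X in _ <= X]mulrAC ler_wpM2l//; last by rewrite lerDl.
  by rewrite mulr_ge0 ?(ltW B1)//; case/andP: ed => /ltW.
- move=> e u v ed ua va.
  rewrite -scalerBr opprB addrA subrK.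
  apply: le_trans (key e u (b + rho e *: sigma e v) (u - v) ed (rsd _ _ ed ua) (rsd _ _ ed va) _) _.
    by rewrite opprD addrACA subrr add0r -scalerBr (linear_funB (sl e)).
  apply: le_trans (bb e u (b + rho e *: sigma e v) (u - v) ed (rs _ _ ed ua) (rs _ _ ed va)) _.
  rewrite ler_wpM2r// ler_pM ?(ltW B1)//.
  - by case/andP: ed => /ltW.
  - by rewrite ler_peMr// ltW.
  - by rewrite -addrA lerDl addr_ge0.
Qed.

(** * Matrix-valued maps, ordinary derivatives, inverse and square root *)

Lemma mx_norm_rowP (R : realType) (p q : nat) (A : 'M[R]_(p, q)) (x : R) :
  0 <= x -> (forall i, `|row i A| <= x) -> `|A| <= x.
Proof.
move=> x0 h; rewrite [leLHS]/Num.Def.normr /= mx_normrE; apply: bigmax_le => // -[i j] _ /=.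
apply: le_trans (h i); rewrite [leRHS]/Num.Def.normr /= mx_normrE.
by apply/bigmax_geP; right; exists (0, j) => //=; rewrite mxE.
Qed.

Lemma mx_norm_row (R : realType) (p q : nat) (A : 'M[R]_(p, q)) i : `|row i A| <= `|A|.
Proof.
rewrite [leLHS]/Num.Def.normr [leRHS]/Num.Def.normr /= !mx_normrE; apply: bigmax_le.
  by apply/bigmax_geP; left.
by move=> [k j] _ /=; apply/bigmax_geP; right; exists (i, j) => //=; rewrite mxE.
Qed.

Lemma mx_norm_entry (R : realType) (p q : nat) (A : 'M[R]_(p, q)) i j :
  `|A i j| <= `|A|.
Proof.
rewrite [leRHS]/Num.Def.normr /= mx_normrE.
by apply/bigmax_geP; right; exists (i, j).
Qed.

Lemma udiff_rows (R : realType) (V : normedModType R) (p q : nat)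
    (H : R -> V -> 'M[R]_(p, q)) a c L :
  (forall i, udiff (fun e u => row i (H e u)) a (row i c) (fun h => row i (L h))) ->
  udiff H a c L.
Proof.
move=> HL; split.
  move=> k x y; apply/row_matrixP => i; have [-> _] := HL i.
  by rewrite linearD linearZ.
have /(_ _)/cid HL2 i := (HL i).2; pose C i := sval (HL2 i).
have /(_ _)/cid HL3 i := svalP (HL2 i); pose d i := sval (HL3 i).
have CdP i := svalP (HL3 i).
(* With no rows, the + 1 keeps the constant positive and the default 1 keeps the radius positive;
   that default also provides the clause d <= 1. *)
exists (\sum_i C i + 1), (\big[Num.min/1]_i d i).
have C0 i : 0 <= C i by have [/ltW] := CdP i.
have CC i : C i <= \sum_i C i + 1.
  by rewrite (bigD1 i)//= -addrA lerDl addr_ge0// sumr_ge0.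
have D0 : 0 < \big[Num.min/1]_i d i.
  by apply: lt_bigmin => [|i _]; [exact: ltr01|have [] := CdP i].
have dd i : \big[Num.min/1]_i d i <= d i by exact: bigmin_le.
have S0 : 0 < \sum_i C i + 1 by rewrite ltr_wpDl// sumr_ge0.
split => //.
  exact: bigmin_le_id.
have B i := udiff_bound_le (CC i) (dd i) (let: And4 _ _ _ b := CdP i in b).
split.
- move=> h; apply: mx_norm_rowP => [|i]; first by rewrite mulr_ge0// ltW.
  by have [b1 _ _] := B i; exact: b1.
- move=> e ed; apply: mx_norm_rowP => [|i].
    by rewrite mulr_ge0 ?(ltW S0)//; case/andP: ed => /ltW.
  by have [_ b2 _] := B i; rewrite linearB; exact: b2.
- move=> e u v ed ua va; apply: mx_norm_rowP => [|i].
    by rewrite !mulr_ge0 ?(ltW S0) ?addr_ge0//; case/andP: ed => /ltW.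
  by have [_ _ b3] := B i; rewrite !linearB; exact: b3.
Qed.

Lemma sdiff_differentiable (R : realType) (V W : normedModType R) (f : V -> W) a L :
  sdiff f a L -> differentiable f a /\ 'd f a = L :> (V -> W).
Proof.
move=> [Ll [C [d [C0 d0 d1 [b1 _ b3]]]]].
pose Lm : {linear V -> W} := HB.pack L (GRing.isLinear.Build R V W *:%R L Ll).
have Lc : continuous Lm.
  apply: bounded_linear_continuous; apply/linear_boundedP; exists C; split; first exact: num_real.
  move=> r Cr x; apply: le_trans (b1 x) _; by rewrite ler_wpM2r// ltW.
have E : f \o shift a = cst (f a) + Lm +o_ 0 id.
  apply/eqaddoP => eps eps0; near=> h.
  have hd : `|h| <= d by near: h; apply: nbhs0_le.
  have he : `|h| <= eps / (2 * C).
    by near: h; apply: nbhs0_le; rewrite divr_gt0// mulr_gt0.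
  rewrite -[X in `|X|]/(f (h + a) - (f a + L h)) opprD addrA.
  have [->|h0] := eqVneq h 0.
    by rewrite add0r (linear_fun0 Ll) subr0 subrr !normr0 mulr0.
  have nh : 0 < `|h| by rewrite normr_gt0.
  (* For a constant family e is free; taking e = |h| turns the remainder into 2 C |h|^2. *)
  have := b3 `|h| (h + a) a.
  rewrite addrK nh hd subrr normr0 addr0 ltW// => /(_ isT isT isT).
  move=> /le_trans; apply.
  rewrite ler_wpM2r// -mulr2n -mulr_natl mulrA [C * 2]mulrC.
  move: he; rewrite ler_pdivlMr ?mulr_gt0// => he.
  by apply: le_trans he; rewrite [in leRHS]mulrC.
have dE := diff_unique Lc E.
split; last exact: dE.
by apply/diff_locallyP; rewrite dE.
Unshelve. all: by end_near. Qed.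

Lemma sdiffI (R : realType) (V W : normedModType R) (f : V -> W) a L (C d : R) :
  linear L -> 0 < C -> 0 < d -> (forall h, `|L h| <= C * `|h|) ->
  (forall u v, `|u - a| <= d -> `|v - a| <= d ->
     `|f u - f v - L (u - v)| <= C * (`|u - a| + `|v - a|) * `|u - v|) ->
  sdiff f a L.
Proof.
move=> Ll C0 d0 b1 b3; split=> //; exists C, (Num.min d 1); split=> //.
- by rewrite lt_min d0 ltr01.
- by rewrite ge_min lexx orbT.
split=> //.
- by move=> e /andP[e0 _]; rewrite subrr normr0 mulr_ge0 ?ltW.
- move=> e u v /andP[e0 _]; rewrite !le_min => /andP[ua _] /andP[va _].
  apply: le_trans (b3 _ _ ua va) _; rewrite ler_wpM2r// ler_wpM2l ?(ltW C0)//.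
  by rewrite -addrA lerDr ltW.
Qed.

Lemma linear_mulr (R : realType) (k : R) : linear (fun h : R => h * k).
Proof. by move=> l x y; rewrite mulrDl -!scalerAl. Qed.

Lemma sdiff_inv (R : realType) (s : R) : 0 < s ->
  sdiff (@GRing.inv R) s (fun h => h * - (s ^+ 2)^-1).
Proof.
(* For x, y within s / 2 of s, both are at least s / 2. The numerator of the remainder is at most
   3/2 s times the distances and the inverse of its denominator at most 4 s^-4, whence 6 s^-3; the
   other summand bounds the linear part. *)
move=> s0; pose C := 6 * (s ^+ 3)^-1 + (s ^+ 2)^-1.
have C6 : 0 < 6 * (s ^+ 3)^-1 by rewrite mulr_gt0 ?invr_gt0 ?exprn_gt0.
have C2 : 0 < (s ^+ 2)^-1 by rewrite invr_gt0 exprn_gt0.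
apply: (@sdiffI _ _ _ _ _ _ C (s / 2)) => //.
- exact: linear_mulr.
- exact: addr_gt0.
- by rewrite divr_gt0.
- by move=> h; rewrite normrM normrN mulrC ler_wpM2r// ger0_norm ?(ltW C2)// /C lerDr (ltW C6).
- move=> x y xs ys.
  have /andP[x1 x2] : - (s / 2) <= x - s <= s / 2 by rewrite -ler_norml.
  have /andP[y1 y2] : - (s / 2) <= y - s <= s / 2 by rewrite -ler_norml.
  have x3 : s / 2 <= x by lra.
  have y3 : s / 2 <= y by lra.
  have x0 : 0 < x by lra.
  have y0 : 0 < y by lra.
  have -> : x^-1 - y^-1 - (x - y) * - (s ^+ 2)^-1 =
      (x * (y - s) + s * (x - s)) * (s ^+ 2 * (x * y))^-1 * (x - y).
    by field; rewrite !gt_eqF.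
  rewrite normrM ler_wpM2r// normrM.
  have i0 : 0 < s ^+ 2 * (x * y) by rewrite !mulr_gt0// exprn_gt0.
  rewrite [`|_^-1|]gtr0_norm ?invr_gt0//.
  have h1 : `|x * (y - s) + s * (x - s)| <= 3 / 2 * s * (`|x - s| + `|y - s|).
    apply: le_trans (ler_normD _ _) _; rewrite !normrM (gtr0_norm x0) (gtr0_norm s0).
    rewrite mulrDr addrC; apply: lerD; rewrite ler_wpM2r//; lra.
  have h2 : (s ^+ 2 * (x * y))^-1 <= 4 * (s ^+ 4)^-1.
    rewrite -[4]invrK -invfM lef_pV2 ?posrE ?mulr_gt0 ?invr_gt0 ?exprn_gt0//.
    rewrite (_ : 4^-1 * s ^+ 4 = s ^+ 2 * (s / 2 * (s / 2))); last by field.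
    by rewrite ler_pM2l ?exprn_gt0// ler_pM// divr_ge0// ltW.
  apply: (@le_trans _ _ (3 / 2 * s * (`|x - s| + `|y - s|) * (4 * (s ^+ 4)^-1))).
    by rewrite ler_pM// invr_ge0 ltW.
  rewrite mulrAC ler_wpM2r ?addr_ge0//.
  rewrite (_ : 3 / 2 * s * _ = 6 * (s ^+ 3)^-1); first by rewrite /C lerDl ltW.
  by field; rewrite gt_eqF.
Qed.

Lemma sdiff_sqrt (R : realType) (s : R) : 0 < s ->
  sdiff (Num.sqrt : R -> R) s (fun h => h * (2 * Num.sqrt s)^-1).
Proof.
move=> s0; set r := Num.sqrt s; have r0 : 0 < r by rewrite sqrtr_gt0.
have r2 : r ^+ 2 = s by rewrite sqr_sqrtr// ltW.
(* The radius 3/4 s used below makes both roots at least r / 2, so that their sum, by which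
   differences of roots are divided, is at least r. *)
pose C := (2 * r ^+ 3)^-1 + (2 * r)^-1.
have C6 : 0 < (2 * r ^+ 3)^-1 by rewrite invr_gt0 mulr_gt0 ?exprn_gt0.
have C2 : 0 < (2 * r)^-1 by rewrite invr_gt0 mulr_gt0.
apply: (@sdiffI _ _ _ _ _ _ C (3 / 4 * s)) => //.
- exact: linear_mulr.
- exact: addr_gt0.
- by rewrite mulr_gt0// divr_gt0.
- by move=> h; rewrite normrM mulrC ler_wpM2r// ger0_norm ?(ltW C2)// /C lerDr (ltW C6).
have root (x : R) : `|x - s| <= 3 / 4 * s ->
    [/\ r / 2 <= Num.sqrt x, Num.sqrt x ^+ 2 = x & `|Num.sqrt x - r| <= `|x - s| / r].
  rewrite {1}ler_norml => /andP[x1 x2]; have x3 : s / 4 <= x by lra.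
  have x0 : 0 <= x by lra.
  have q2 : Num.sqrt x ^+ 2 = x by rewrite sqr_sqrtr.
  split=> //.
    rewrite -(@ler_pXn2r _ 2) ?nnegrE ?sqrtr_ge0 ?divr_ge0 ?(ltW r0)//.
    by rewrite q2 expr_div_n r2 expr2 -natrM.
  rewrite ler_pdivlMr// -{2}q2 -r2 subr_sqr normrM ler_wpM2l//.
  by rewrite ger0_norm ?addr_ge0 ?sqrtr_ge0// ?(ltW r0)// lerDr sqrtr_ge0.
move=> x y /root[p1 p2 p3] /root[q1 q2 q3].
set p := Num.sqrt x in p1 p2 p3 *; set q := Num.sqrt y in q1 q2 q3 *.
have pq : r <= p + q by lra.
have pq0 : 0 < p + q by apply: lt_le_trans pq.
have -> : p - q - (x - y) * (2 * r)^-1 = (p - q) * ((r - p) + (r - q)) / (2 * r).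
  by rewrite -p2 -q2; field; rewrite gt_eqF.
have h1 : `|p - q| <= `|x - y| / r.
  by rewrite ler_pdivlMr// -p2 -q2 subr_sqr normrM ler_wpM2l// ger0_norm// ltW.
have h2 : `|(r - p) + (r - q)| <= (`|x - s| + `|y - s|) / r.
  apply: le_trans (ler_normD _ _) _; rewrite mulrDl.
  by apply: lerD; rewrite distrC.
rewrite !normrM [`|_^-1|]gtr0_norm//.
apply: (@le_trans _ _ (`|x - y| / r * ((`|x - s| + `|y - s|) / r) / (2 * r))).
  by rewrite ler_wpM2r ?(ltW C2)// ler_pM.
rewrite (_ : _ / _ = (2 * r ^+ 3)^-1 * (`|x - s| + `|y - s|) * `|x - y|).
  by rewrite !ler_wpM2r ?addr_ge0// lerDl ltW.
by field; rewrite gt_eqF.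
Qed.

(** * Linear maps on matrices, zeros of families and kernels of their derivatives *)

Lemma linear_mx_bounded (R : realType) (p q : nat) (W : normedModType R)
    (L : 'M[R]_(p, q) -> W) : linear L ->
  exists2 C : R, 0 < C & forall h, `|L h| <= C * `|h|.
Proof.
move=> Ll; pose C := \sum_i \sum_j `|L (delta_mx i j)| + 1.
have S0 : 0 <= \sum_i \sum_j `|L (delta_mx i j)|.
  by apply: sumr_ge0 => i _; apply: sumr_ge0.
exists C; first by rewrite ltr_wpDl.
move=> h; pose Lm : {linear 'M[R]_(p, q) -> W} :=
  HB.pack L (GRing.isLinear.Build R _ W *:%R L Ll).
rewrite {1}[h]matrix_sum_delta -[L _]/(Lm _) linear_sum.
apply: (@le_trans _ _ ((\sum_i \sum_j `|L (delta_mx i j)|) * `|h|)); last first.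
  by rewrite ler_wpM2r// lerDl.
rewrite mulr_suml; apply: le_trans (ler_norm_sum _ _ _) _; apply: ler_sum => i _.
rewrite mulr_suml linear_sum; apply: le_trans (ler_norm_sum _ _ _) _.
apply: ler_sum => j _; rewrite linearZ normrZ mulrC ler_wpM2l//.
exact: mx_norm_entry.
Qed.

Lemma linear_mx_inj_inv (R : realType) (p q : nat)
    (L : 'M[R]_(p, q) -> 'M[R]_(p, q)) : linear L -> (forall h, L h = 0 -> h = 0) ->
  exists (K : 'M[R]_(p, q) -> 'M[R]_(p, q)) (C : R),
    [/\ linear K, cancel L K, cancel K L, 0 < C & forall h, `|K h| <= C * `|h|].
Proof.
move=> Ll Li; pose Lm : {linear 'M[R]_(p, q) -> 'M[R]_(p, q)} :=
  HB.pack L (GRing.isLinear.Build R _ _ *:%R L Ll).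
have Lu : lin_mx Lm \in unitmx.
  rewrite -row_free_unit; apply: inj_row_free => v.
  rewrite -[v]vec_mxK mul_vec_lin => /eqP; rewrite mxvec_eq0 => /eqP /Li ->.
  by rewrite linear0.
pose K y := vec_mx (mxvec y *m invmx (lin_mx Lm)) : 'M[R]_(p, q).
have Kl : linear K by move=> k x y; rewrite /K linearP mulmxDl linearD -scalemxAl linearZ.
have [C C0 KC] := linear_mx_bounded Kl.
exists K, C; split=> //.
  by move=> x; rewrite /K -[L x]/(Lm x) -mul_vec_lin mulmxK// mxvecK.
move=> x; rewrite /K -[L _]/(Lm _); apply: (can_inj mxvecK).
by rewrite -mul_vec_lin vec_mxK mulmxKV.
Qed.

(* Makes 'M[R]_(p, q) a completeNormedModType, as the fixed point theorem needs. *)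
HB.instance Definition _ (R : realType) (p q : nat) := Complete.on 'M[R]_(p, q).

(* The map u |-> u - L^-1 (H e u) contracts a ball of radius O(e) about a. *)
Lemma udiff_zero (R : realType) (p q : nat)
    (H : R -> 'M[R]_(p, q) -> 'M[R]_(p, q)) a L :
  udiff H a 0 L -> (forall h, L h = 0 -> h = 0) ->
  exists C d : R, [/\ 0 < C, 0 < d & forall e : R, 0 < e <= d ->
    exists2 u, H e u = 0 & `|u - a| <= C * e].
Proof.
move=> [Ll [C [d [C0 d0 d1 [b1 b2 b3]]]]] Li.
have [K [B [Kl LK KL B0 KB]]] := linear_mx_inj_inv Ll Li.
(* The first step of the iteration has length at most B C e, half of the radius D e; with
   contraction factor 1/2 the ball is mapped into itself. *)
pose D : R := 2 * B * C.
have D0 : 0 < D by rewrite !mulr_gt0.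
(* The first bound gives both e <= d and D e <= d, the second makes the contraction factor at most
   1/2. *)
pose d' : R := Num.min (d / (1 + D)) (2 * B * C * (1 + 2 * D))^-1.
have D1 : 0 < 1 + D by rewrite addr_gt0.
have D2 : 0 < 2 * B * C * (1 + 2 * D) by rewrite !mulr_gt0 ?addr_gt0 ?mulr_gt0.
have d'0 : 0 < d' by rewrite lt_min divr_gt0 ?invr_gt0.
exists D, d'; split=> // e /andP[e0]; rewrite le_min => /andP[ed ed2].
have {}ed : e * (1 + D) <= d by rewrite -ler_pdivlMr.
have ed1 : e <= d by apply: le_trans ed; rewrite ler_peMr ?(ltW e0)// lerDl ltW.
have De : D * e <= d by apply: le_trans ed; rewrite mulrDr mulr1 mulrC lerDr ltW.
have {}ed2 : B * (C * (e + D * e + D * e)) <= 2^-1.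
  move: ed2; rewrite -[X in _ <= X]mul1r ler_pdivlMr// => ed2.
  rewrite -(@ler_pM2l _ 2)// mulfV//; apply: le_trans ed2.
  by rewrite le_eqVlt; apply/orP; left; apply/eqP; ring.
have De0 : 0 <= D * e by rewrite mulr_ge0 ?ltW.
pose X := [set u : 'M[R]_(p, q) | `|u - a| <= D * e].
pose T u := u - K (H e u).
have ee : 0 < e <= d by rewrite e0.
have TT u v : X u -> X v -> `|T u - T v| <= 2^-1 * `|u - v|.
  move=> Xu Xv; have -> : T u - T v = - K (H e u - H e v - L (u - v)).
    rewrite (linear_funB Kl) LK (linear_funB Kl) /T [RHS]opprB.
    by rewrite !opprD !opprK addrACA.
  rewrite normrN; apply: le_trans (KB _) _.
  apply: le_trans (ler_wpM2l (ltW B0) (b3 _ _ _ ee (le_trans Xu De) (le_trans Xv De))) _.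
  rewrite mulrA ler_wpM2r//; apply: le_trans ed2.
  by rewrite ler_wpM2l ?(ltW B0)// ler_wpM2l ?(ltW C0)// !lerD.
have Xa : X a by rewrite /X /= subrr normr0.
have funT : set_fun X X T.
  move=> u Xu; rewrite /X /= -[T u](subrK (T a)) -addrA.
  apply: le_trans (ler_normD _ _) _.
  have h1 : `|T a - a| <= 2^-1 * (D * e).
    rewrite /T addrAC subrr add0r normrN; apply: le_trans (KB _) _.
    have := b2 _ ee; rewrite subr0 => /(ler_wpM2l (ltW B0)) /le_trans; apply.
    by rewrite le_eqVlt; apply/orP; left; apply/eqP; rewrite /D; field.
  have h2 : `|T u - T a| <= 2^-1 * (D * e).
    by apply: le_trans (TT _ _ Xu Xa) _; rewrite ler_wpM2l.
  by apply: le_trans (lerD h2 h1) _; rewrite -mulrDl -[X in (X + X) * _]mul1r -splitr mul1r.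
pose Tf : {fun X >-> X} := HB.pack T (isFun.Build _ _ X X T funT).
have ctr : is_contraction Tf.
  exists (2^-1)%:nng; split => /=; first by rewrite invf_lt1// ltr1n.
  by move=> [u v] /= [Xu Xv]; exact: TT.
have Xcl : closed X.
  have -> : X = closed_ball a (D * e).
    rewrite closed_ballE ?mulr_gt0//; apply/funext => u.
    by rewrite /X /closed_ball_ /= distrC.
  exact: closed_ball_closed.
have [u Xu /= uT] := banach_fixed_point ctr Xcl (ex_intro _ a Xa).
exists u => //; have : K (H e u) = 0.
  by apply/eqP; rewrite -oppr_eq0 -(inj_eq (addrI u)) addr0; apply/eqP.
by move=> /(congr1 L); rewrite KL (linear_fun0 Ll).
Qed.

(** A short vector k in the kernel of M hardly changes H e between u and u + k, while H e changes
    there nearly by L k. So L k is small compared with k, against the bound on the inverse of L.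
    Only increments of H e are used. *)
Lemma udiff_derivative_inj (R : realType) (p q : nat)
    (H : R -> 'M[R]_(p, q) -> 'M[R]_(p, q)) a c L :
  udiff H a c L -> (forall h, L h = 0 -> h = 0) ->
  exists2 d : R, 0 < d & forall (e : R) u M, 0 < e <= d -> `|u - a| <= d ->
    sdiff (H e) u M -> forall h, M h = 0 -> h = 0.
Proof.
move=> [Ll [C [d [C0 d0 d1 [b1 b2 b3]]]]] Li.
have [K [B [Kl LK KL B0 KB]]] := linear_mx_inj_inv Ll Li.
(* With every threshold equal to 1/8 of the critical size, the error of L weighs at most 4/8 and
   that of M at most 2/8, which leads to 1 <= 3/4. *)
pose d' : R := Num.min (d / 2) (8 * B * C)^-1.
have d'0 : 0 < d' by rewrite lt_min divr_gt0 ?invr_gt0 ?mulr_gt0.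
exists d' => // e u M /andP[e0]; rewrite !le_min => /andP[ed ed2] /andP[ud ud2].
move=> [Ml [C' [t [C'0 t0 t1 [_ _ b3']]]]] h Mh.
apply/eqP; apply: contraT => h0; have nh : 0 < `|h| by rewrite normr_gt0.
have ed1 : e <= d by apply: le_trans ed _; rewrite ler_pdivrMr// ler_peMr ?ler1n// ltW.
(* The length given to the kernel vector. It depends on C', the rate of differentiability of H e at
   u, whereas d' must not. *)
pose s : R := Num.min (Num.min t (d / 2)) (Num.min (8 * B * C)^-1 (8 * B * C')^-1).
have s0 : 0 < s by rewrite !lt_min t0 divr_gt0 ?invr_gt0 ?mulr_gt0.
have [st sd sC sC'] : [/\ s <= t, s <= d / 2, s <= (8 * B * C)^-1 & s <= (8 * B * C')^-1].
  by split; rewrite /s !ge_min lexx ?orbT.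
pose k := (s / `|h|) *: h.
have nk : `|k| = s by rewrite normrZ normrM normfV normr_id divfK ?gt_eqF// gtr0_norm.
have Mk : M k = 0 by rewrite (linear_funZ Ml) Mh scaler0.
have ud1 : `|u - a| <= d by apply: le_trans ud _; rewrite ler_pdivrMr// ler_peMr ?ler1n// ltW.
have ukd : `|u + k - a| <= d.
  rewrite addrAC; apply: le_trans (ler_normD _ _) _; rewrite nk.
  by apply: le_trans (lerD ud sd) _; rewrite -splitr.
have h1 := b3 e (u + k) u _ ukd ud1.
have h2 := b3' s (u + k) u.
have kE : u + k - u = k by rewrite addrC addKr.
rewrite kE nk in h1; rewrite kE nk Mk subr0 subrr normr0 addr0 in h2.
have {}h1 := h1 ltac:(by rewrite e0).
have {}h2 := h2 ltac:(by rewrite s0) st (ltW t0).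
have : `|k| <= B * (C * (e + `|u + k - a| + `|u - a|) * s + C' * (s + s) * s).
  rewrite -[k in X in X <= _]LK; apply: le_trans (KB _) _; rewrite ler_wpM2l ?(ltW B0)//.
  rewrite -[L k](subKr (H e (u + k) - H e u)).
  apply: le_trans (ler_normB _ _) _; rewrite addrC; exact: lerD.
rewrite nk -mulrDl mulrA -[X in X <= _]mul1r ler_pM2r// => h3.
have cl (x y : R) : 0 < y -> x <= y^-1 -> x * y <= 1.
  by move=> y0; rewrite -[X in _ <= X]mul1r ler_pdivlMr.
have C8 : 0 < 8 * B * C by rewrite !mulr_gt0.
have C'8 : 0 < 8 * B * C' by rewrite !mulr_gt0.
have ukd2 : `|u + k - a| <= `|u - a| + s.
  by rewrite addrAC -nk ler_normD.
have aux (x y : R) : e * (8 * B * C) <= 1 -> x * (8 * B * C) <= 1 ->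
    s * (8 * B * C) <= 1 -> s * (8 * B * C') <= 1 -> y <= x + s ->
    B * (C * (e + y + x) + C' * (s + s)) <= 3 / 4.
  move=> p1 p2 p3 p4 p5.
  have {}p5 : B * C * y <= B * C * (x + s) by rewrite ler_wpM2l// mulr_ge0// ltW.
  by move: p1 p2 p3 p4 p5; clear; lra.
have := le_trans h3 (aux _ _ (cl _ _ C8 ed2) (cl _ _ C8 ud2) (cl _ _ C8 sC) (cl _ _ C'8 sC') ukd2).
by clear; lra.
Qed.

(** * Newtonian attraction in the plane *)

Lemma udiff_linear_mx (R : realType) (p q : nat) (W : normedModType R)
    (L : 'M[R]_(p, q) -> W) a : linear L -> udiff (fun=> L) a (L a) L.
Proof. by move=> Ll; have [C _ LC] := linear_mx_bounded Ll; exact: udiff_linear LC. Qed.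

Lemma sdiff_comp_linear (R : realType) (p q : nat) (V W : normedModType R)
    (f : V -> W) (g : 'M[R]_(p, q) -> V) a L :
  linear g -> sdiff f (g a) L -> sdiff (fun u => f (g u)) a (fun h => L (g h)).
Proof. by move=> gl fL; apply: udiff_comp fL _; exact: udiff_linear_mx. Qed.

Definition dot (R : realType) (u v : 'rV[R]_2) : R := \sum_i u 0 i * v 0 i.

Definition rot90 (R : realType) (v : 'rV[R]_2) : 'rV[R]_2 :=
  \row_j (if j == 0 then - v 0 1 else v 0 0).

Definition kern (R : realType) (v : 'rV[R]_2) : 'rV[R]_2 := enorm v ^- 3 *: v.

Definition dkern (R : realType) (a h : 'rV[R]_2) : 'rV[R]_2 :=
  enorm a ^- 3 *: h - (3 * dot a h * enorm a ^- 5) *: a.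

Section plane.
Variable R : realType.
Implicit Types (u v w a h : 'rV[R]_2) (k : R).

Lemma rV2P u v : u 0 0 = v 0 0 -> u 0 1 = v 0 1 -> u = v.
Proof.
move=> h0 h1; apply/rowP => i; case: i => [[|[|//]]] i2.
  by rewrite (_ : Ordinal i2 = 0)//; apply/val_inj.
by rewrite (_ : Ordinal i2 = 1)//; apply/val_inj.
Qed.

Lemma dotE u v : dot u v = u 0 0 * v 0 0 + u 0 1 * v 0 1.
Proof. by rewrite /dot !big_ord_recl big_ord0 addr0; congr (_ + u 0 _ * v 0 _); apply/val_inj. Qed.

Lemma rot0E v : rot90 v 0 0 = - v 0 1. Proof. by rewrite mxE. Qed.
Lemma rot1E v : rot90 v 0 1 = v 0 0. Proof. by rewrite mxE. Qed.

Lemma dotC u v : dot u v = dot v u.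
Proof. by rewrite !dotE; ring. Qed.

Lemma dot_linear u : linear (dot u : 'rV[R]_2 -> R).
Proof. by move=> k v w; rewrite !dotE !mxE -[_ *: _]/(_ * _); ring. Qed.

Lemma dotDr u v w : dot u (v + w) = dot u v + dot u w.
Proof. exact: (linear_funD (dot_linear u)). Qed.
Lemma dotBr u v w : dot u (v - w) = dot u v - dot u w.
Proof. exact: (linear_funB (dot_linear u)). Qed.
Lemma dotZr u k v : dot u (k *: v) = k * dot u v.
Proof. exact: (linear_funZ (dot_linear u)). Qed.
Lemma dot0r u : dot u 0 = 0.
Proof. exact: (linear_fun0 (dot_linear u)). Qed.
Lemma dotBl u v w : dot (v - w) u = dot v u - dot w u.
Proof. by rewrite !(dotC _ u) dotBr. Qed.
Lemma dotZl u k v : dot (k *: v) u = k * dot v u.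
Proof. by rewrite !(dotC _ u) dotZr. Qed.
Lemma dot0l u : dot 0 u = 0.
Proof. by rewrite dotC dot0r. Qed.
Lemma dotNl u v : dot (- v) u = - dot v u.
Proof. by rewrite -scaleN1r dotZl mulN1r. Qed.

Lemma dot_sumr (I : Type) (r : seq I) (P : pred I) u (F : I -> 'rV[R]_2) :
  dot u (\sum_(i <- r | P i) F i) = \sum_(i <- r | P i) dot u (F i).
Proof. by apply: big_morph => [v w|]; rewrite ?dotDr ?dot0r. Qed.

Lemma dot_suml (I : Type) (r : seq I) (P : pred I) u (F : I -> 'rV[R]_2) :
  dot (\sum_(i <- r | P i) F i) u = \sum_(i <- r | P i) dot (F i) u.
Proof. by rewrite dotC dot_sumr; apply: eq_bigr => i _; rewrite dotC. Qed.

Lemma rot_linear : linear (@rot90 R).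
Proof. by move=> k u v; apply: rV2P; rewrite !mxE//= ?opprD ?mulrN. Qed.

Lemma dot_rot u : dot (rot90 u) u = 0.
Proof. by rewrite !dotE !rot0E !rot1E; ring. Qed.

Lemma dot_rot2 u v : dot (rot90 u) (rot90 v) = dot u v.
Proof. by rewrite !dotE !rot0E !rot1E; ring. Qed.

Lemma enormE v : enorm v = Num.sqrt (dot v v).
Proof. by []. Qed.

Lemma dot_ge0 v : 0 <= dot v v.
Proof. by rewrite dotE addr_ge0// -expr2 sqr_ge0. Qed.

Lemma enorm_sqr v : enorm v ^+ 2 = dot v v.
Proof. by rewrite enormE sqr_sqrtr// dot_ge0. Qed.

Lemma dot_gt0 v : v != 0 -> 0 < dot v v.
Proof.
move=> v0; rewrite lt_def dot_ge0 andbT; apply: contra v0 => /eqP.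
rewrite dotE => /eqP; rewrite paddr_eq0 -?expr2 ?sqr_ge0// !sqrf_eq0.
by move=> /andP[/eqP v0 /eqP v1]; apply/eqP/rV2P; rewrite mxE.
Qed.

Lemma enorm_gt0 v : v != 0 -> 0 < enorm v.
Proof. by move=> v0; rewrite enormE sqrtr_gt0 dot_gt0. Qed.

Lemma kernN v : kern (- v) = - kern v.
Proof. by rewrite /kern !enormE dotNl dotC dotNl opprK scalerN. Qed.

Lemma kern_scale k v : 0 < k -> kern (k *: v) = k ^- 2 *: kern v.
Proof.
move=> k0; rewrite /kern !enormE dotZl dotZr mulrA -expr2 sqrtrM ?sqr_ge0//.
rewrite sqrtr_sqr gtr0_norm// !scalerA; congr (_ *: _).
by rewrite exprMn invfM mulrAC; congr (_ * _); field; rewrite gt_eqF.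
Qed.

Lemma dkernNl a h : dkern (- a) h = dkern a h.
Proof.
rewrite /dkern !enormE !dotNl (dotC _ (- a)) dotNl opprK scalerN.
by rewrite mulrN mulNr scaleNr opprK.
Qed.

Lemma dkern_linear a : linear (dkern a).
Proof.
move=> k u v; rewrite /dkern; apply: rV2P; rewrite !mxE dotDr dotZr; ring.
Qed.

(** [kern] is the gradient of - 1/|v|, so its derivative is self-adjoint. *)
Lemma dkern_sym a u v : dot (dkern a u) v = dot u (dkern a v).
Proof. by rewrite /dkern dotBl dotBr !dotZl !dotZr (dotC u a); ring. Qed.

(** The infinitesimal form of the equivariance of [kern] under rotations. *)
Lemma dkern_rot a : dkern a (rot90 a) = rot90 (kern a).
Proof.
by rewrite /dkern dotC dot_rot mulr0 mul0r scale0r subr0 /kern (linear_funZ rot_linear).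
Qed.

Lemma udiff_dot (V : normedModType R) (F G : R -> V -> 'rV[R]_2) (a : V) c c' L M :
  udiff F a c L -> udiff G a c' M ->
  udiff (fun e x => dot (F e x) (G e x)) a (dot c c')
        (fun y => dot (L y) c' + dot c (M y)).
Proof.
move=> FF GG.
have coord (H : R -> V -> 'rV[R]_2) b K i : udiff H a b K ->
    udiff (fun e x => H e x 0 i : R) a (b 0 i : R) (fun y => K y 0 i : R).
  move=> HH; have cl : linear (fun v : 'rV[R]_2 => v 0 i : R).
    by move=> k u v; rewrite !mxE.
  exact: (udiff_comp (udiff_linear_mx b cl) HH).
apply: udiff_eq (udiff_sum (P := predT) (index_enum 'I_2)
  (fun i _ => udiff_scale (coord _ _ _ i FF) (coord _ _ _ i GG))) => //.
by move=> y; rewrite big_split.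
Qed.

Lemma sdiff_enormV a : a != 0 ->
  sdiff (fun v => (enorm v)^-1 : R) a (fun h => - dot (kern a) h).
Proof.
move=> a0; have e0 := enorm_gt0 a0.
have id1 : sdiff (fun v : 'rV[R]_2 => v) a id by apply: udiff_linear_mx.
have d1 : sdiff (fun v => dot v v) a _ := udiff_dot id1 id1.
have d2 := udiff_comp (sdiff_sqrt (dot_gt0 a0)) d1.
have d3 := udiff_comp (sdiff_inv e0) d2.
apply: udiff_eq d3 => // h /=.
rewrite -enormE /kern dotZl (dotC h); field; rewrite gt_eqF//.
Qed.

(** The factor |v|^-3 is treated as a product of three copies of |v|^-1, so that [sdiff_enormV] and
    the product rule suffice. *)
Lemma sdiff_kern a : a != 0 -> sdiff (@kern R) a (dkern a).
Proof.
move=> a0; have e0 := enorm_gt0 a0; have d := sdiff_enormV a0.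
have id1 : sdiff (fun v : 'rV[R]_2 => v) a id by apply: udiff_linear_mx.
have := udiff_scale (udiff_scale d (udiff_scale d d)) id1.
have E x : (enorm x)^-1 *: ((enorm x)^-1 *: (enorm x)^-1 : R) = enorm x ^- 3.
  by rewrite -![_ *: _]/(_ * _) -expr2 -exprS exprVn.
apply: udiff_eq => [e x _||y]; rewrite E//.
rewrite /dkern addrC; congr (_ + _).
rewrite -scaleNr; congr (_ *: _).
rewrite -![_ *: _]/(_ * _) /kern !dotZl; field; rewrite gt_eqF//.
Qed.

End plane.

(** * Central configurations and their rotational degeneracy *)

Lemma finite_pos_lb (R : realType) (I : finType) (f : I -> R) :
  (forall i, 0 < f i) -> exists2 r : R, 0 < r & forall i, r <= f i.
Proof.
move=> f0; exists (\big[Num.min/1]_i f i).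
  by apply: lt_bigmin => [|i _] //; exact: ltr01.
by move=> i; exact: bigmin_le.
Qed.

Lemma udiff_neq0 (R : realType) (V W : normedModType R) (H : R -> V -> W) a c L :
  udiff H a c L -> c != 0 ->
  exists2 r : R, 0 < r &
    forall (e : R) u, 0 < e <= r -> `|u - a| <= r -> H e u != 0.
Proof.
move=> [_ [C [d [C0 d0 d1 b]]]] c0.
have nc : 0 < `|c| by rewrite normr_gt0.
(* With e and the distance both at most |c| / (16 C), the value estimate 4 C (e + distance) is at
   most |c| / 2. *)
exists (Num.min d (`|c| / (16 * C))).
  by rewrite lt_min d0 divr_gt0// mulr_gt0.
move=> e u /andP[e0]; rewrite !le_min => /andP[ed ec] /andP[ud uc].
apply/eqP => H0; have := udiff_bound_val C0 d0 d1 b (introT andP (conj e0 ed)) ud.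
rewrite H0 sub0r normrN => h.
have : `|c| <= 4 * C * (`|c| / (16 * C) + `|c| / (16 * C)).
  by apply: le_trans h _; rewrite ler_wpM2l ?mulr_ge0 ?(ltW C0)// lerD.
have E (x : R) : 4 * C * (x / (16 * C) + x / (16 * C)) = x / 2.
  by field; rewrite gt_eqF.
by rewrite E ler_pdivlMr// ger_pMr// leNgt ltr1n.
Qed.

Lemma udiff_neq0_fin (R : realType) (V W : normedModType R) (I : finType)
    (P : pred I) (H : I -> R -> V -> W) a c L :
  (forall i, P i -> udiff (H i) a (c i) (L i)) -> (forall i, P i -> c i != 0) ->
  exists2 r : R, 0 < r &
    forall (e : R) u, 0 < e <= r -> `|u - a| <= r -> forall i, P i -> H i e u != 0.
Proof.
move=> HL c0.
have : forall i, exists r : R, 0 < r /\ (P i ->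
    forall (e : R) u, 0 < e <= r -> `|u - a| <= r -> H i e u != 0).
  move=> i; case: (boolP (P i)) => Pi; last by exists 1.
  by have [r r0 rH] := udiff_neq0 (HL i Pi) (c0 i Pi); exists r.
move=> /(_ _)/cid f.
have [r r0 rf] := finite_pos_lb (fun i => (svalP (f i)).1).
exists r => // e u /andP[e0 er] ur i Pi.
by apply: (svalP (f i)).2 => //; [rewrite e0 (le_trans er)|exact: le_trans (rf i)].
Qed.

Lemma row_linear (R : realType) (p q : nat) (i : 'I_p) : linear (@row R p q i).
Proof. by move=> k u v; rewrite linearP. Qed.

Lemma rowB_linear (R : realType) (p q : nat) (i j : 'I_p) :
  linear (fun A : 'M[R]_(p, q) => row i A - row j A).
Proof.
move=> k u v; rewrite (linear_funD (@row_linear _ _ _ i)) (linear_funD (@row_linear _ _ _ j)).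
by rewrite !linearZ /= scalerBr opprD addrACA.
Qed.

Lemma collision_freeP (R : realType) (n : nat) (Q : 'M[R]_(n, 2)) :
  collision_free Q <-> forall i j : 'I_n, i != j -> row i Q - row j Q != 0.
Proof.
split=> [cf i j|h i j].
  by apply: contra; rewrite subr_eq0 => /eqP/cf ->.
move=> /= /eqP; rewrite -subr_eq0 => /eqP ij; apply/eqP; apply: contraT => /h.
by rewrite ij eqxx.
Qed.

Lemma collision_free_near (R : realType) (n : nat) (Q : 'M[R]_(n, 2)) :
  collision_free Q -> exists2 r : R, 0 < r &
    forall Q', `|Q' - Q| <= r -> collision_free Q'.
Proof.
move=> /collision_freeP cf.
have [r r0 h] := @udiff_neq0_fin R _ _ ('I_n * 'I_n)%type (fun ij => ij.1 != ij.2)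
  (fun ij => fun=> fun A => row ij.1 A - row ij.2 A) Q _ _
  (fun ij _ => udiff_linear_mx Q (rowB_linear ij.1 ij.2)) (fun ij => cf ij.1 ij.2).
exists r => // Q' Q'r; apply/collision_freeP => i j ij.
by apply: (h r Q' _ Q'r (i, j)) => //; rewrite r0 lexx.
Qed.

Definition ncc_der (R : realType) (n : nat) (m : 'rV[R]_n) (Q V : 'M[R]_(n, 2)) :
    'M[R]_(n, 2) :=
  \matrix_(i < n) (row i V - \sum_(j < n | j != i)
     m 0 j *: dkern (row i Q - row j Q) (row i V - row j V)).

Lemma row_ncc_map (R : realType) (n : nat) (m : 'rV[R]_n) (Q : 'M[R]_(n, 2)) i :
  row i (ncc_map m Q) =
  row i Q - \sum_(j < n | j != i) m 0 j *: kern (row i Q - row j Q).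
Proof.
rewrite rowK; congr (_ - _); apply: eq_bigr => j _.
by rewrite /kern scalerA.
Qed.

Lemma row_ncc_der (R : realType) (n : nat) (m : 'rV[R]_n) (Q V : 'M[R]_(n, 2)) i :
  row i (ncc_der m Q V) = row i V - \sum_(j < n | j != i)
     m 0 j *: dkern (row i Q - row j Q) (row i V - row j V).
Proof. exact: rowK. Qed.

Lemma sdiff_ncc_map (R : realType) (n : nat) (m : 'rV[R]_n) (Q : 'M[R]_(n, 2)) :
  collision_free Q -> sdiff (ncc_map m) Q (ncc_der m Q).
Proof.
move=> /collision_freeP cf; apply: udiff_rows => i.
have cfi j : j != i -> row i Q - row j Q != 0 by rewrite eq_sym; exact: cf.
have h := udiffB (udiff_linear_mx Q (row_linear i)) (udiff_sum (P := fun j => j != i)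
  (index_enum 'I_n) (fun j ji => udiffZ (m 0 j)
    (sdiff_comp_linear (rowB_linear i j) (sdiff_kern (cfi j ji))))).
by apply: udiff_eq h => [e u _||u]; rewrite ?row_ncc_map ?row_ncc_der.
Qed.

Lemma ncc_der_linear (R : realType) (n : nat) (m : 'rV[R]_n) (Q : 'M[R]_(n, 2)) :
  linear (ncc_der m Q).
Proof.
move: (ncc_der m Q) (row_ncc_der m Q) => D DE k u v; apply/row_matrixP => i.
rewrite (row_linear i k (D u) (D v)) !DE.
rewrite scalerBr [RHS]addrACA -opprD -(@row_linear _ _ _ i); congr (_ - _).
rewrite scaler_sumr -big_split /=; apply: eq_bigr => j _.
by rewrite (rowB_linear i j) dkern_linear scalerDr !scalerA mulrC.
Qed.

Lemma diff_ncc_map (R : realType) (n : nat) (m : 'rV[R]_n) (Q : 'M[R]_(n, 2)) :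
  collision_free Q -> 'd (ncc_map m) Q = ncc_der m Q :> (_ -> _).
Proof. by move=> /(sdiff_ncc_map m)/sdiff_differentiable[]. Qed.

(** The velocity of Q under uniform rotation, tangent to its orbit; the J Q of the overview. *)
Definition rotm (R : realType) (n : nat) (Q : 'M[R]_(n, 2)) : 'M[R]_(n, 2) :=
  \matrix_(i < n) rot90 (row i Q).

(** The map commutes with simultaneous rotations of all bodies; this is the derivative of that
    identity. At a zero of the map it puts [rotm Q] in the kernel. *)
Lemma ncc_der_rot (R : realType) (n : nat) (m : 'rV[R]_n) (Q : 'M[R]_(n, 2)) :
  ncc_der m Q (rotm Q) = rotm (ncc_map m Q).
Proof.
apply/row_matrixP => i; rewrite row_ncc_der [RHS]rowK row_ncc_map rowK.
rewrite (linear_funB (@rot_linear R)); congr (_ - _).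
rewrite (big_morph (@rot90 R) (linear_funD (@rot_linear R)) (linear_fun0 (@rot_linear R))).
apply: eq_bigr => j _; rewrite rowK -(linear_funB (@rot_linear R)) dkern_rot.
by rewrite (linear_funZ (@rot_linear R) (m 0 j)).
Qed.

Lemma sum_antisym (R : realType) (n : nat) (F : 'I_n -> 'I_n -> R) :
  (forall i j, F j i = - F i j) -> \sum_i \sum_(j < n | j != i) F i j = 0.
Proof.
move=> FN; set S := LHS.
suff : S = - S by move=> /esym/eqP; rewrite eqNr => /eqP.
rewrite {1}/S (exchange_big_dep predT)//= -sumrN; apply: eq_bigr => j _.
rewrite -sumrN; apply: eq_big => [i|i _]; first by rewrite eq_sym.
by rewrite FN.
Qed.

(* The total torque vanishes: q_i - q_j and the force between i and j are parallel. *)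
Lemma ncc_pairing (R : realType) (n : nat) (m : 'rV[R]_n) (Q : 'M[R]_(n, 2)) :
  \sum_i m 0 i * dot (rot90 (row i Q)) (row i (ncc_map m Q)) = 0.
Proof.
pose F i j := m 0 i * (m 0 j * dot (rot90 (row i Q)) (kern (row i Q - row j Q))).
transitivity (- \sum_i \sum_(j < n | j != i) F i j).
  rewrite -sumrN; apply: eq_bigr => i _; rewrite row_ncc_map dotBr dot_rot sub0r.
  rewrite mulrN dot_sumr mulr_sumr; congr (- _); apply: eq_bigr => j _.
  by rewrite dotZr.
rewrite sum_antisym ?oppr0// => i j; rewrite /F.
have -> : row j Q - row i Q = - (row i Q - row j Q) by rewrite opprB.
rewrite kernN -[- kern _]scaleN1r dotZr mulN1r !mulrN mulrCA; congr (- (_ * (_ * _))).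
apply/eqP; rewrite -subr_eq0 -dotBl -(linear_funB (@rot_linear R)).
by rewrite -opprB (linear_funN (@rot_linear R)) dotNl /kern dotZr dot_rot mulr0 oppr0.
Qed.

(** Multiplied by the masses, the map is a gradient, so its derivative is symmetric for the
    mass-weighted product. The kernel therefore also describes the defect of the range. The terms of
    a pair of bodies cancel by [dkern_sym]. *)
Lemma ncc_der_sym (R : realType) (n : nat) (m : 'rV[R]_n) (Q U V : 'M[R]_(n, 2)) :
  \sum_i m 0 i * dot (row i U) (row i (ncc_der m Q V)) =
  \sum_i m 0 i * dot (row i (ncc_der m Q U)) (row i V).
Proof.
move: (ncc_der m Q) (row_ncc_der m Q) => G GE.
pose D i j := dkern (row i Q - row j Q).
have DC i j : D j i = D i j.
  by apply/funext => h; rewrite /D -dkernNl opprB.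
have DN i j h : D i j (- h) = - D i j h.
  exact: (linear_funN (@dkern_linear _ _)).
pose F i j := m 0 i * (m 0 j *
  (dot (row i U) (D i j (row i V - row j V)) - dot (D i j (row i U - row j U)) (row i V))).
apply/eqP; rewrite -subr_eq0 -sumrB; apply/eqP.
transitivity (- \sum_i \sum_(j < n | j != i) F i j).
  rewrite -sumrN; apply: eq_bigr => i _; rewrite !GE dotBr dotBl -mulrBr.
  have -> (x y z : R) : x - y - (x - z) = - (y - z) by ring.
  rewrite dot_sumr dot_suml -sumrB mulrN mulr_sumr; congr (- _).
  by apply: eq_bigr => j _; rewrite dotZr dotZl -mulrBr.
rewrite sum_antisym ?oppr0// => i j; rewrite /F DC mulrCA -!mulrN.
congr (_ * (_ * _)).
rewrite -(opprB (row i V)) -(opprB (row i U)) !DN -[- D _ _ _]scaleN1r dotZr.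
rewrite -[- D _ _ _]scaleN1r dotZl !mulN1r opprK.
have := dkern_sym (row i Q - row j Q) (row i U - row j U) (row i V - row j V).
rewrite -/(D i j) dotBr dotBl => h.
lra.
Qed.

(** * Singular linear maps with a rank one correction *)

Section rank_one_correction.
Variables (R : realType) (p q : nat) (f : {linear 'M[R]_(p, q) -> 'M[R]_(p, q)}).
Variable x : 'M[R]_(p, q).
Hypotheses (x0 : x != 0) (fx : f x = 0).

Let x_ker : (mxvec x <= kermx (lin_mx f))%MS.
Proof. by apply/sub_kermxP; rewrite mul_vec_lin fx linear0. Qed.

Lemma kernel_span v : (\rank (lin_mx f) + 1 = p * q)%N -> f v = 0 ->
  exists c : R, v = c *: x.
Proof.
move=> rk fv.
have v_ker : (mxvec v <= kermx (lin_mx f))%MS.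
  by apply/sub_kermxP; rewrite mul_vec_lin fv linear0.
have rx : \rank (mxvec x) = 1%N.
  by rewrite rank_rV mxvec_eq0 x0.
have rk1 : \rank (kermx (lin_mx f)) = 1%N.
  by rewrite mxrank_ker; apply/eqP; rewrite -(eqn_add2l (\rank (lin_mx f))) subnKC ?rank_leq_row// rk.
have : (mxvec x == kermx (lin_mx f))%MS.
  by rewrite -(geq_leqif (mxrank_leqif_eq x_ker)) rk1 rx.
move=> /andP[_] /(submx_trans v_ker) /sub_rVP[c vc].
by exists c; apply: (can_inj mxvecK); rewrite linearZ.
Qed.

Lemma rank_of_inj_correction (lam : 'M[R]_(p, q) -> R) (w : 'M[R]_(p, q)) :
  linear lam -> (forall v, f v + lam v *: w = 0 -> v = 0) ->
  (\rank (lin_mx f) + 1 = p * q)%N.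
Proof.
move=> laml inj; apply/eqP; rewrite eqn_leq; apply/andP; split.
  rewrite addn1 ltn_neqAle rank_leq_row andbT.
  apply/negP => rf; have : row_free (lin_mx f) by [].
  rewrite -kermx_eq0 => /eqP k0; move: x_ker; rewrite k0 submx0 mxvec_eq0.
  by apply/negP.
(* The column c represents lam, so [c *m mxvec w], of rank at most 1, is the matrix of the
   correction. *)
pose c : 'cV[R]_(p * q) := \col_a lam (vec_mx (delta_mx 0 a)).
have lamE v : v *m c = (lam (vec_mx v))%:M.
  apply/rowP => i; rewrite !ord1 !mxE /= mulr1n [in RHS](row_sum_delta v).
  pose L : {linear 'M[R]_(p, q) -> R} := HB.pack lam (GRing.isLinear.Build R _ _ *:%R lam laml).
  rewrite linear_sum -[lam _]/(L _) linear_sum; apply: eq_bigr => j _.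
  by rewrite linearZ [RHS]linearZ mxE.
have rf : row_free (lin_mx f + c *m mxvec w).
  apply: inj_row_free => v; rewrite mulmxDr mulmxA lamE mul_scalar_mx.
  rewrite -{1}[v]vec_mxK mul_vec_lin -linearZ -linearD => /eqP.
  by rewrite mxvec_eq0 => /eqP/inj/(congr1 mxvec); rewrite vec_mxK linear0.
have : (p * q <= \rank (lin_mx f + c *m mxvec w)%R)%N by rewrite (eqP rf).
move=> /leq_trans; apply; apply: leq_trans (mxrank_add _ _) _.
by rewrite leq_add2l (leq_trans (mxrankM_maxl _ _))// rank_leq_col.
Qed.

End rank_one_correction.

Lemma rotm_eq0 (R : realType) (n : nat) (Q : 'M[R]_(n, 2)) : rotm Q = 0 -> Q = 0.
Proof.
move=> /row_matrixP h; apply/row_matrixP => i; have := h i; rewrite rowK !row0.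
move=> /rowP ri; apply: rV2P.
  by have := ri 1; rewrite rot1E !mxE.
by have := ri 0; rewrite rot0E !mxE => /eqP; rewrite oppr_eq0 => /eqP.
Qed.

(** If Q = 0, absence of collisions leaves at most one body; the sums are empty and the derivative
    is the identity, whose rank 2n contradicts 2n - 1. *)
Lemma nondegenerate_ncc_neq0 (R : realType) (n : nat) (m : 'rV[R]_n) (Q : 'M[R]_(n, 2)) :
  nondegenerate_ncc m Q -> Q != 0.
Proof.
move=> [[cf F0] rk]; apply/eqP => Q0.
have idE V : 'd (ncc_map m) Q V = V.
  rewrite diff_ncc_map//; apply/row_matrixP => i; rewrite row_ncc_der big_pred0 ?subr0// => j.
  by apply/negbTE; rewrite negbK; apply/eqP/cf; rewrite Q0 !row0.
have : row_free (lin_mx ('d (ncc_map m) Q)).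
  apply: inj_row_free => v; rewrite -[v]vec_mxK mul_vec_lin idE.
  by rewrite vec_mxK.
by move=> /eqP rf; move: rk; rewrite rf mulnC addn1 => /eqP; rewrite -[X in _ == X]addn0 -addn1 eqn_add2l.
Qed.

Lemma nondegenerate_ncc_kernel (R : realType) (n : nat) (m : 'rV[R]_n) (Q V : 'M[R]_(n, 2)) :
  nondegenerate_ncc m Q -> ncc_der m Q V = 0 -> exists c : R, V = c *: rotm Q.
Proof.
move=> nd; have Q0 := nondegenerate_ncc_neq0 nd; have [[cf F0] rk] := nd.
have dE := diff_ncc_map m cf.
rewrite -dE; apply: kernel_span.
- by apply: contra Q0 => /eqP/rotm_eq0/eqP.
- rewrite dE ncc_der_rot F0; apply/row_matrixP => i; rewrite rowK !row0.
  exact: (linear_fun0 (@rot_linear R)).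
- by rewrite rk mulnC.
Qed.

Lemma nondegenerate_ncc_of_inj (R : realType) (n : nat) (m : 'rV[R]_n) (Q w : 'M[R]_(n, 2))
    (lam : 'M[R]_(n, 2) -> R) :
  normalized_cc m Q -> Q != 0 -> linear lam ->
  (forall V, ncc_der m Q V + lam V *: w = 0 -> V = 0) -> nondegenerate_ncc m Q.
Proof.
move=> /[dup] ncc [cf F0] Q0 ll inj; split=> //.
have dE := diff_ncc_map m cf.
rewrite [RHS]mulnC; apply: (@rank_of_inj_correction _ _ _ _ (rotm Q)) ll _.
- by apply: contra Q0 => /eqP/rotm_eq0/eqP.
- rewrite dE ncc_der_rot F0; apply/row_matrixP => i; rewrite rowK !row0.
  exact: (linear_fun0 (@rot_linear R)).
- by move=> v; rewrite dE; exact: inj.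
Qed.

(** * The restricted problem and the potential of the light bodies *)

(** The inner differential is known only at points near a, and [udiff_ext] allows the formula g to
    replace it there before the second differentiation. *)
Lemma diff_near (R : realType) (V W : normedModType R) (f : V -> W) (g : V -> V -> W) (a u : V) L
    (r : R) : 0 < r -> (forall y, `|y - a| <= r -> sdiff f y (g y)) ->
  sdiff (fun y => g y u) a L -> 'd (fun y => 'd f y u) a = L :> (V -> W).
Proof.
move=> r0 fg gL; apply: (proj2 (sdiff_differentiable _)).
apply: udiff_ext gL => //.
  exists r => // e y _ ya.
  by rewrite (proj2 (sdiff_differentiable (fg y ya))).
have aa : `|a - a| <= r by rewrite subrr normr0 ltW.
by rewrite (proj2 (sdiff_differentiable (fg a aa))).
Qed.

Lemma sdiffB_const (R : realType) (p q : nat) (W : normedModType R) (f : 'M[R]_(p, q) -> W) b a L :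
  sdiff f (a - b) L -> sdiff (fun y => f (y - b)) a L.
Proof.
move=> fL; have id1 : udiff (fun=> id) a a id := udiff_linear_mx a (fun k x y => erefl).
have h := udiff_comp fL (udiffB id1 (udiff_cst a b)).
by apply: udiff_eq h => // y; rewrite subr0.
Qed.

Section restricted.
Variables (R : realType) (N : nat) (m : 'rV[R]_N) (Q : 'M[R]_(N, 2)).

Definition Vres_grad (y : 'rV[R]_2) : 'rV[R]_2 :=
  y - \sum_(i < N) m 0 i *: kern (y - row i Q).

Definition Vres_hess (x h : 'rV[R]_2) : 'rV[R]_2 :=
  h - \sum_(i < N) m 0 i *: dkern (x - row i Q) h.

Lemma sdiff_Vres y : (forall i, y - row i Q != 0) ->
  sdiff (Vres m Q) y (dot (Vres_grad y)).
Proof.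
move=> yQ; have id1 : udiff (fun=> id) y y id := udiff_linear_mx y (fun k x y => erefl).
have h := udiffD (udiffZ 2^-1 (udiff_dot id1 id1)) (udiff_sum (P := predT) (index_enum 'I_N)
  (fun i _ => udiffZ (m 0 i) (sdiffB_const (sdiff_enormV (yQ i))))).
have E x : 2^-1 *: dot x x + \sum_i m 0 i *: (enorm (x - row i Q))^-1 = Vres m Q x :> R.
  by rewrite /Vres enorm_sqr mulrC.
apply: udiff_eq h => [e u _||u]; rewrite ?E//.
rewrite /Vres_grad dotBl (dotC u) dot_suml; congr (_ + _).
  by have e (z : R) : 2^-1 * (z + z) = z by [field]; exact: e.
by rewrite -sumrN; apply: eq_bigr => i _; rewrite -[_ *: _]/(_ * _) mulrN dotZl.
Qed.

Lemma sdiff_Vres_grad x : (forall i, x - row i Q != 0) ->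
  sdiff Vres_grad x (Vres_hess x).
Proof.
move=> xQ; have id1 : udiff (fun=> id) x x id := udiff_linear_mx x (fun k x y => erefl).
have h := udiffB id1 (udiff_sum (P := predT) (index_enum 'I_N)
  (fun i _ => udiffZ (m 0 i) (sdiffB_const (sdiff_kern (xQ i))))).
exact: udiff_eq h.
Qed.

Lemma Vres_hess_linear x : linear (Vres_hess x).
Proof.
move=> k u v; rewrite /Vres_hess scalerBr addrACA -opprD; congr (_ - _).
rewrite scaler_sumr -big_split /=; apply: eq_bigr => j _.
by rewrite dkern_linear scalerDr !scalerA mulrC.
Qed.

Lemma Vres_hess_sym x u v : dot (Vres_hess x u) v = dot u (Vres_hess x v).
Proof.
rewrite dotBl dotBr dot_suml dot_sumr; congr (_ - _); apply: eq_bigr => i _.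
by rewrite dotZl dotZr dkern_sym.
Qed.

Lemma second_derivative_Vres x u v : (forall i, x - row i Q != 0) ->
  second_derivative (Vres m Q) x u v = dot (Vres_hess x v) u.
Proof.
move=> xQ; rewrite /second_derivative.
have id1 : udiff (fun=> id) x x id := udiff_linear_mx x (fun k x y => erefl).
have [r r0 rH] := udiff_neq0_fin (P := predT)
  (fun i _ => udiffB id1 (udiff_cst x (row i Q))) (fun i _ => xQ i).
have h := udiff_dot (sdiff_Vres_grad xQ) (udiff_cst x u).
have h1 y : `|y - x| <= r -> sdiff (Vres m Q) y (dot (Vres_grad y)).
  by move=> yx; apply: sdiff_Vres => i; apply: (rH r y) => //; rewrite r0 lexx.
have -> := diff_near r0 h1 (_ : sdiff _ x (fun v => dot (Vres_hess x v) u)) => //.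
by apply: udiff_eq h => // y; rewrite dot0r addr0.
Qed.

Lemma critical_point_Vres x : (forall i, x - row i Q != 0) ->
  critical_point (Vres m Q) x -> Vres_grad x = 0.
Proof.
move=> xQ [_ /(_ (Vres_grad x))].
rewrite (proj2 (sdiff_differentiable (sdiff_Vres xQ))) => g0.
by apply/eqP; apply: contraT => /dot_gt0; rewrite g0 ltxx.
Qed.

End restricted.

(** Action and reaction: the derivative of a pair potential, a sum over pairs, is regrouped as a sum
    of the total force on each body. *)
Lemma sum_ltn_symmetrize (R : realType) (k : nat) (mu : 'rV[R]_k)
    (X : 'I_k -> 'I_k -> 'rV[R]_2) (u : 'M[R]_(k, 2)) :
  (forall i j, X j i = - X i j) ->
  \sum_(i < k) \sum_(j < k | (i < j)%N) mu 0 i * mu 0 j * dot (X i j) (row i u - row j u) =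
  \sum_(i < k) mu 0 i * dot (\sum_(j < k | j != i) mu 0 j *: X i j) (row i u).
Proof.
move=> XN.
pose F i j := mu 0 i * mu 0 j * dot (X i j) (row i u).
transitivity (\sum_(i < k) (\sum_(j < k | (i < j)%N) F i j + \sum_(j < k | (j < i)%N) F i j)).
  rewrite big_split /= [X in _ + X](exchange_big_dep predT)//= -big_split /=.
  apply: eq_bigr => i _; rewrite -big_split /=; apply: eq_bigr => j _.
  by rewrite /F (XN i j) dotNl dotBr mulrBr mulrN (mulrC (mu 0 j)).
apply: eq_bigr => i _; rewrite dot_suml mulr_sumr [RHS](bigID (fun j : 'I_k => (i < j)%N)) /=.
congr (_ + _); apply: eq_big => [j|j _]; rewrite ?/F ?dotZl ?mulrA//.
  by apply/idP/andP => [ij|[]//]; split=> //; apply: contraTneq ij => ->; rewrite ltnn.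
by rewrite -leqNgt ltn_neqAle.
Qed.

Lemma linear_mx_expand (R : realType) (p q : nat) (f : {linear 'M[R]_(p, q) -> R})
    (V : 'M[R]_(p, q)) :
  f V = \sum_b f (vec_mx (delta_mx 0 b)) * mxvec V 0 b.
Proof.
rewrite -{1}[V]mxvecK {1}[mxvec V]row_sum_delta !linear_sum; apply: eq_bigr => b _.
by rewrite linearZ linearZ_LR mulrC.
Qed.

Section wtilde.
Variables (R : realType) (N k : nat) (m : 'rV[R]_N) (Q : 'M[R]_(N, 2)).
Variables (x : 'rV[R]_2) (mu : 'rV[R]_k).
Hypotheses (xQ : forall i, x - row i Q != 0) (mu0 : forall j, 0 < mu 0 j).

(** The partial gradient of [Wtilde] divided by mu_j, which is the form in which it arises as the
    limit of the light equations. [Wtilde_hess] is divided in the same way. *)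
Definition Wtilde_grad (P : 'M[R]_(k, 2)) (j : 'I_k) : 'rV[R]_2 :=
  Vres_hess m Q x (row j P)
  - \sum_(l < k | l != j) mu 0 l *: kern (row j P - row l P).

Definition Wtilde_hess (P V : 'M[R]_(k, 2)) (j : 'I_k) : 'rV[R]_2 :=
  Vres_hess m Q x (row j V)
  - \sum_(l < k | l != j) mu 0 l *: dkern (row j P - row l P) (row j V - row l V).

Lemma sdiff_Wtilde P : collision_free P ->
  sdiff (Wtilde m Q x mu) P
        (fun V => \sum_j mu 0 j * dot (Wtilde_grad P j) (row j V)).
Proof.
move=> /collision_freeP cf.
have hess_row j : linear (fun y : 'M[R]_(k, 2) => Vres_hess m Q x (row j y)).
  by move=> c u v; rewrite row_linear Vres_hess_linear.
have quad j := udiffZ (mu 0 j / 2) (udiff_dot (udiff_linear_mx P (hess_row j))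
  (udiff_linear_mx P (@row_linear R k 2 j))).
have cf_lt (i j : 'I_k) : (i < j)%N -> row i P - row j P != 0.
  by move=> ij; apply: cf; apply: contraTneq ij => ->; rewrite ltnn.
have pot (i : 'I_k) := udiff_sum (P := fun j : 'I_k => (i < j)%N) (index_enum 'I_k)
  (fun j ij => udiffZ (mu 0 i * mu 0 j)
    (sdiff_comp_linear (@rowB_linear R k 2 i j) (sdiff_enormV (cf_lt i j ij)))).
have h := udiffD (udiff_sum (P := predT) (index_enum 'I_k) (fun j _ => quad j))
                 (udiff_sum (P := predT) (index_enum 'I_k) (fun i _ => pot i)).
have E y : \sum_j mu 0 j / 2 *: dot (Vres_hess m Q x (row j y)) (row j y)
    + \sum_(i < k) \sum_(j < k | (i < j)%N) (mu 0 i * mu 0 j) *: (enorm (row i y - row j y))^-1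
    = Wtilde m Q x mu y :> R.
  rewrite /Wtilde; congr (_ + _); apply: eq_bigr => j _.
  by rewrite second_derivative_Vres.
apply: udiff_eq h => [e u _||V]; rewrite ?E//.
transitivity (\sum_j mu 0 j * dot (Vres_hess m Q x (row j P)) (row j V)
  - \sum_(i < k) \sum_(j < k | (i < j)%N) mu 0 i * mu 0 j *
      dot (kern (row i P - row j P)) (row i V - row j V)).
  rewrite -sumrN; congr (_ + _).
    apply: eq_bigr => j _; rewrite -[_ *: _]/(_ * _) Vres_hess_sym dotC.
    have e (y z : R) : y / 2 * (z + z) = y * z by [field]; exact: e.
  apply: eq_bigr => i _; rewrite -sumrN; apply: eq_bigr => j _.
  by rewrite -[_ *: _]/(_ * _) mulrN.
rewrite (@sum_ltn_symmetrize _ _ _ (fun i j => kern (row i P - row j P))).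
  by rewrite -sumrB; apply: eq_bigr => j _; rewrite -mulrBr -dotBl.
by move=> i j; rewrite -kernN opprB.
Qed.

Lemma critical_point_Wtilde P : collision_free P ->
  critical_point (Wtilde m Q x mu) P -> forall j, Wtilde_grad P j = 0.
Proof.
(* Testing with the gradient itself gives a sum of terms mu_j |grad_j|^2, all of which must
   vanish. *)
move=> cf [_ /(_ (\matrix_j Wtilde_grad P j))].
rewrite (proj2 (sdiff_differentiable (sdiff_Wtilde cf))) => /eqP.
rewrite psumr_eq0 => [|i _]; last by rewrite rowK mulr_ge0 ?dot_ge0// ltW.
move=> /allP h j; apply/eqP; apply: contraT => /dot_gt0 g0.
by have := h j (mem_index_enum _); rewrite rowK implyTb gt_eqF// mulr_gt0.
Qed.

Lemma second_derivative_Wtilde P U V : collision_free P ->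
  second_derivative (Wtilde m Q x mu) P U V =
  \sum_j mu 0 j * dot (Wtilde_hess P V j) (row j U).
Proof.
move=> cf; rewrite /second_derivative.
have [r r0 rH] := collision_free_near cf; have /collision_freeP cfP := cf.
have cfj j l : l != j -> row j P - row l P != 0 by rewrite eq_sym; exact: cfP.
have hess_row j : linear (fun y : 'M[R]_(k, 2) => Vres_hess m Q x (row j y)).
  by move=> c u v; rewrite row_linear Vres_hess_linear.
have grad j : sdiff (fun y => Wtilde_grad y j) P (fun V => Wtilde_hess P V j) :=
  udiffB (udiff_linear_mx P (hess_row j)) (udiff_sum (P := fun l => l != j)
    (index_enum 'I_k) (fun l lj => udiffZ (mu 0 l)
    (sdiff_comp_linear (@rowB_linear R k 2 j l) (sdiff_kern (cfj j l lj))))).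
have h := udiff_sum (P := predT) (index_enum 'I_k) (fun j _ =>
  udiffZ (mu 0 j) (udiff_dot (grad j) (udiff_cst P (row j U)))).
have -> := diff_near r0 (fun y yP => sdiff_Wtilde (rH y yP))
  (_ : sdiff _ P (fun V => \sum_j mu 0 j * dot (Wtilde_hess P V j) (row j U))) => //.
apply: udiff_eq h => // y; apply: eq_bigr => j _.
by rewrite dot0r addr0.
Qed.

Lemma Wtilde_hess_inj P : collision_free P -> hessian (Wtilde m Q x mu) P \in unitmx ->
  forall V, (forall j, Wtilde_hess P V j = 0) -> V = 0.
Proof.
move=> cf hu V V0; suff : (mxvec V)^T = 0.
  by move=> /(congr1 trmx); rewrite trmxK trmx0 => /eqP; rewrite mxvec_eq0 => /eqP.
apply: (can_inj (mulKmx hu)); rewrite mulmx0; apply/colP => a; rewrite !mxE.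
under eq_bigr => b _ do rewrite !mxE.
transitivity (second_derivative (Wtilde m Q x mu) P (vec_mx (delta_mx 0 a)) V).
  apply: esym; exact: (linear_mx_expand
    ('d (fun y => 'd (Wtilde m Q x mu) y (vec_mx (delta_mx 0 a)) : R) P) V).
rewrite second_derivative_Wtilde// big1// => j _.
by rewrite V0 dot0l mulr0.
Qed.

End wtilde.

(** * Blow-up of the equations at scales e^3 and e *)

Section rescaled_kernel.
Variables (R : realType) (p q : nat) (A B : 'M[R]_(p, q) -> 'rV[R]_2) (a : 'M[R]_(p, q)).
Variable b : 'rV[R]_2.
Hypotheses (Al : linear A) (Bl : linear B).

(** A light and a massive body are displaced by e P_j and e^3 S_i. In units of e this is A u + e^2 B
    u, and B drops out of the limit. For two massive bodies, in units of e^3, B is 0. *)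
Lemma udiff_rescale_quadratic (W : normedModType R) (f : 'rV[R]_2 -> W) L (rho : R -> R) :
  sdiff f b L -> (forall e : R, 0 < e <= 1 -> 0 < rho e <= e) ->
  udiff (fun e u => (rho e)^-1 *: (f (b + rho e *: (A u + e ^+ 2 *: B u)) - f b)) a
        (L (A a)) (fun h => L (A h)).
Proof.
move=> fL rhoe; have [CA CA0 AC] := linear_mx_bounded Al.
have [CB CB0 BC] := linear_mx_bounded Bl.
apply: (udiff_rescale (S := CA + CB) (sigma := fun e u => A u + e ^+ 2 *: B u) _ fL rhoe _ Al).
- by move=> e c u v; rewrite Al Bl scalerDr !scalerDr !scalerA mulrC addrACA.
- by move=> h; apply: le_trans (AC h) _; rewrite ler_wpM2r// lerDl ltW.
- move=> e h /andP[e0 e1]; rewrite addrC addKr normrZ ger0_norm ?sqr_ge0//.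
  apply: le_trans (ler_wpM2l (sqr_ge0 e) (BC h)) _.
  rewrite mulrA ler_wpM2r// mulrC ler_pM ?sqr_ge0 ?(ltW CB0)// ?lerDr ?(ltW CA0)//.
  by rewrite expr2 ler_piMl// ltW.
Qed.

(** The displacement carries a factor e, so the limit is the constant f b. Hence the light bodies
    act on the massive ones, in the limit, as a fixed source. *)
Lemma udiff_mule_shift (W : normedModType R) (f : 'rV[R]_2 -> W) L :
  sdiff f b L ->
  udiff (fun e u => f (b + e *: (A u + e ^+ 2 *: B u))) a (f b) (fun=> 0).
Proof.
move=> fL; have ide (e : R) : 0 < e <= 1 -> 0 < e <= e by case/andP => -> _; rewrite lexx.
have h := udiffD (udiff_cst a (f b)) (udiff_mule (udiff_rescale_quadratic (rho := id) fL ide)).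
apply: udiff_eq h => [e u e0||y]; rewrite ?addr0//=.
by rewrite scalerA divff ?gt_eqF// scale1r addrC subrK.
Qed.

Lemma udiff_shift :
  udiff (fun e u => b + e *: (A u + e ^+ 2 *: B u)) a b (fun=> 0).
Proof. by apply: (@udiff_mule_shift _ id id); exact: udiff_linear_mx. Qed.

End rescaled_kernel.

Section split_configurations.
Variables (R : realType) (N k : nat).

Definition aniso (s t : R) (u : 'M[R]_(N + k, 2)) : 'M[R]_(N + k, 2) :=
  col_mx (s *: usubmx u) (t *: dsubmx u).

Lemma row_anisoL s t u i : row (lshift k i) (aniso s t u) = s *: row (lshift k i) u.
Proof. by rewrite rowKu linearZ /= row_usubmx. Qed.

Lemma row_anisoR s t u j : row (rshift N j) (aniso s t u) = t *: row (rshift N j) u.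
Proof. by rewrite rowKd linearZ /= row_dsubmx. Qed.

Lemma split_rowP (u v : 'M[R]_(N + k, 2)) :
  (forall i, row (lshift k i) u = row (lshift k i) v) ->
  (forall j, row (rshift N j) u = row (rshift N j) v) -> u = v.
Proof.
by move=> uv uv'; apply/row_matrixP => i; case: (fintype.split_ordP i) => j ->.
Qed.

Lemma aniso_linear s t : linear (aniso s t).
Proof.
move=> c u v; apply: split_rowP => i;
rewrite (@row_linear _ _ _ _ c) ?row_anisoL ?row_anisoR (@row_linear _ _ _ _ c);
by rewrite scalerDr !scalerA mulrC.
Qed.

Lemma anisoK s t : s != 0 -> t != 0 -> cancel (aniso s t) (aniso s^-1 t^-1).
Proof.
move=> s0 t0 u; apply: split_rowP => i; rewrite ?row_anisoL ?row_anisoR scalerA mulVf//;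
exact: scale1r.
Qed.

Lemma row_ncc_mapL (m : 'rV[R]_N) (mu : 'rV[R]_k) (Z : 'M[R]_(N + k, 2)) i :
  row (lshift k i) (ncc_map (row_mx m mu) Z) =
  row (lshift k i) Z
  - \sum_(l < N | l != i) m 0 l *: kern (row (lshift k i) Z - row (lshift k l) Z)
  - \sum_(j < k) mu 0 j *: kern (row (lshift k i) Z - row (rshift N j) Z).
Proof.
rewrite row_ncc_map big_split_ord /= opprD addrA; congr (_ - _ - _).
  by apply: eq_big => [l|l _]; rewrite ?eq_lshift// row_mxEl.
by apply: eq_big => [l|l _]; rewrite ?eq_rlshift// row_mxEr.
Qed.

Lemma row_ncc_mapR (m : 'rV[R]_N) (mu : 'rV[R]_k) (Z : 'M[R]_(N + k, 2)) j :
  row (rshift N j) (ncc_map (row_mx m mu) Z) =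
  row (rshift N j) Z
  - \sum_(i < N) m 0 i *: kern (row (rshift N j) Z - row (lshift k i) Z)
  - \sum_(l < k | l != j) mu 0 l *: kern (row (rshift N j) Z - row (rshift N l) Z).
Proof.
rewrite row_ncc_map big_split_ord /= opprD addrA; congr (_ - _ - _).
  by apply: eq_big => [l|l _]; rewrite ?eq_lrshift// row_mxEl.
by apply: eq_big => [l|l _]; rewrite ?eq_rshift// row_mxEr.
Qed.

End split_configurations.

Section gauge.
Variables (R : realType) (N : nat) (m : 'rV[R]_N) (Q : 'M[R]_(N, 2)).

(* The zero set of gauge is a slice transverse to the orbit of Q under rotations. *)
Definition gauge (S : 'M[R]_(N, 2)) : R := \sum_i dot (rot90 (row i Q)) (row i S).

Lemma gauge_linear : linear gauge.
Proof.
move=> c u v; rewrite /gauge -[X in _ = X + _]/(c * _) mulr_sumr -big_split /=.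
by apply: eq_bigr => i _; rewrite row_linear dotDr dotZr.
Qed.

Hypotheses (m0 : forall i, 0 < m 0 i) (nd : nondegenerate_ncc m Q).

Lemma row_neq0_exists : exists i, row i Q != 0.
Proof.
apply/existsP; apply: contraT; rewrite negb_exists => /forallP h.
have /eqP[] := nondegenerate_ncc_neq0 nd; apply/row_matrixP => i.
by rewrite row0; apply/eqP; rewrite -[_ == _]negbK.
Qed.

Lemma inertia_gt0 : 0 < \sum_i m 0 i * dot (row i Q) (row i Q).
Proof.
have [i Qi] := row_neq0_exists.
rewrite (bigD1 i)//= ltr_wpDr ?mulr_gt0 ?dot_gt0//.
by apply: sumr_ge0 => l _; rewrite mulr_ge0 ?dot_ge0// ltW.
Qed.

Lemma gauge_rotm_gt0 : 0 < gauge (rotm Q).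
Proof.
have [i Qi] := row_neq0_exists.
rewrite /gauge (bigD1 i)//= rowK dot_rot2 ltr_wpDr ?dot_gt0//.
by apply: sumr_ge0 => l _; rewrite rowK dot_ge0.
Qed.

(** The mass-weighted product with [rotm Q] kills [ncc_der m Q V] by symmetry and leaves [gauge Q V]
    times the moment of inertia, so the gauge vanishes. Then V is a multiple of [rotm Q], on which
    the gauge is positive. *)
Lemma gauged_ncc_der_inj V : ncc_der m Q V + gauge V *: rotm Q = 0 -> V = 0.
Proof.
move=> h; have [[cf F0] _] := nd.
have g0 : gauge V = 0.
  have : \sum_i m 0 i * dot (row i (rotm Q)) (row i (ncc_der m Q V + gauge V *: rotm Q)) = 0.
    by rewrite h big1// => i _; rewrite row0 dot0r mulr0.
  under eq_bigr => i _ do rewrite linearD linearZ /= dotDr dotZr mulrDr mulrCA.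
  rewrite big_split /= ncc_der_sym ncc_der_rot F0 big1 => [|i _]; last first.
    by rewrite rowK row0 (linear_fun0 (@rot_linear R)) dot0l mulr0.
  rewrite add0r -mulr_sumr => /eqP; rewrite mulf_eq0 => /orP[/eqP//|].
  under eq_bigr => i _ do rewrite rowK dot_rot2.
  by rewrite gt_eqF// inertia_gt0.
have [c Vc] : exists c : R, V = c *: rotm Q.
  by apply: (nondegenerate_ncc_kernel nd); move: h; rewrite g0 scale0r addr0.
have : c * gauge (rotm Q) = 0 by rewrite -g0 Vc (linear_funZ gauge_linear).
move/eqP; rewrite mulf_eq0 => /orP[/eqP c0|]; first by rewrite Vc c0 scale0r.
by rewrite gt_eqF// gauge_rotm_gt0.
Qed.

Lemma gauged_linear : linear (fun V => ncc_der m Q V + gauge V *: rotm Q).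
Proof.
move=> c u v; rewrite (ncc_der_linear m Q c u v) (gauge_linear c u v) scalerDl scalerDr scalerA.
exact: addrACA.
Qed.

Lemma gauged_ncc_der_surj G : exists V, ncc_der m Q V + gauge V *: rotm Q = G.
Proof.
have [K [C [_ _ KL _ _]]] := linear_mx_inj_inv gauged_linear gauged_ncc_der_inj.
by exists (K G); exact: KL.
Qed.

End gauge.

Section perturbation.
Variables (R : realType) (N k : nat) (m : 'rV[R]_N) (Q : 'M[R]_(N, 2)) (x : 'rV[R]_2).
Variables (mu : 'rV[R]_k) (P : 'M[R]_(k, 2)).

Definition masses (e : R) : 'rV[R]_(N + k) := row_mx m (e ^+ 3 *: mu).

Definition zoom (e : R) (u : 'M[R]_(N + k, 2)) : 'M[R]_(N + k, 2) :=
  col_mx Q (\matrix_(j < k) x) + aniso (e ^+ 3) e u.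

(* The equations are divided by the scales e^3 and e of the unknowns; the last
   term is the rank one correction that makes the derivative invertible. *)
Definition zoomed_map (e : R) (u : 'M[R]_(N + k, 2)) : 'M[R]_(N + k, 2) :=
  aniso (e ^+ 3)^-1 e^-1 (ncc_map (masses e) (zoom e u))
  + gauge Q (usubmx u) *: col_mx (rotm Q) 0.

Definition zoomed_der (h : 'M[R]_(N + k, 2)) : 'M[R]_(N + k, 2) :=
  col_mx (ncc_der m Q (usubmx h) + gauge Q (usubmx h) *: rotm Q)
         (\matrix_j Wtilde_hess m Q x mu P (dsubmx h) j).

Lemma row_zoomL e u i : row (lshift k i) (zoom e u) = row i Q + e ^+ 3 *: row (lshift k i) u.
Proof. by rewrite linearD /= rowKu row_anisoL. Qed.

Lemma row_zoomR e u j : row (rshift N j) (zoom e u) = x + e *: row (rshift N j) u.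
Proof. by rewrite linearD /= rowKd row_anisoR rowK. Qed.

(** The term [e ^+ 2 *: 0] gives the difference the shape of [udiff_rescale_quadratic] with B =
    0. *)
Lemma zoom_LL e u i l : row (lshift k i) (zoom e u) - row (lshift k l) (zoom e u) =
  (row i Q - row l Q)
  + e ^+ 3 *: (row (lshift k i) u - row (lshift k l) u + e ^+ 2 *: 0).
Proof. by rewrite !row_zoomL opprD addrACA -scalerBr scaler0 addr0. Qed.

Lemma zoom_LR e u i j : row (lshift k i) (zoom e u) - row (rshift N j) (zoom e u) =
  (row i Q - x) + e *: (- row (rshift N j) u + e ^+ 2 *: row (lshift k i) u).
Proof.
rewrite row_zoomL row_zoomR opprD addrACA scalerDr scalerN scalerA -exprS.
by rewrite [- _ + _]addrC.
Qed.

Lemma zoom_RL e u i j : row (rshift N j) (zoom e u) - row (lshift k i) (zoom e u) =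
  (x - row i Q) + e *: (row (rshift N j) u + e ^+ 2 *: - row (lshift k i) u).
Proof.
by rewrite row_zoomL row_zoomR opprD addrACA scalerDr !scalerN scalerA -exprS.
Qed.

Lemma zoom_RR e u j l : row (rshift N j) (zoom e u) - row (rshift N l) (zoom e u) =
  e *: (row (rshift N j) u - row (rshift N l) u).
Proof. by rewrite !row_zoomR opprD addrACA subrr add0r scalerBr. Qed.

Hypotheses (F0 : ncc_map m Q = 0) (gx : Vres_grad m Q x = 0).

(** The division by e^3 leaves difference quotients of [kern], because Q solves its own equations
    and cancels the terms of order 0. The masses e^3 mu absorb the division in the attraction of the
    light bodies. *)
Lemma row_zoomed_mapL (e : R) u i : 0 < e -> row (lshift k i) (zoomed_map e u) =
  row (lshift k i) u
  - \sum_(l < N | l != i) m 0 l *: ((e ^+ 3)^-1 *: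
      (kern ((row i Q - row l Q)
             + e ^+ 3 *: (row (lshift k i) u - row (lshift k l) u + e ^+ 2 *: 0))
       - kern (row i Q - row l Q)))
  - \sum_(j < k) mu 0 j *:
      kern ((row i Q - x) + e *: (- row (rshift N j) u + e ^+ 2 *: row (lshift k i) u))
  + gauge Q (usubmx u) *: rot90 (row i Q).
Proof.
move=> e0; have e3 : e ^+ 3 != 0 by rewrite expf_neq0// gt_eqF.
rewrite linearD linearZ /= rowKu rowK; congr (_ + _).
rewrite row_anisoL row_ncc_mapL.
rewrite (eq_bigr _ (fun l _ => congr1 (fun v => m 0 l *: kern v) (zoom_LL e u i l))).
have -> : \sum_(j < k) (e ^+ 3 *: mu) 0 j *:
      kern (row (lshift k i) (zoom e u) - row (rshift N j) (zoom e u)) =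
    e ^+ 3 *: \sum_(j < k) mu 0 j *:
      kern ((row i Q - x) + e *: (- row (rshift N j) u + e ^+ 2 *: row (lshift k i) u)).
  by rewrite scaler_sumr; apply: eq_bigr => j _; rewrite zoom_LR mxE -scalerA.
rewrite [LHS]scalerBr scalerA mulVf// scale1r; congr (_ - _).
have qi : row i Q = \sum_(l < N | l != i) m 0 l *: kern (row i Q - row l Q).
  by apply/eqP; rewrite -subr_eq0 -row_ncc_map F0 row0.
rewrite row_zoomL {1}qi addrAC -sumrB.
rewrite addrC scalerDr scalerA mulVf// scale1r; congr (_ + _).
rewrite scaler_sumr -sumrN; apply: eq_bigr => l _.
by rewrite -scalerBr scalerA mulrC -scalerA -[RHS]scalerN -[X in _ = _ *: X]scalerN opprB.
Qed.

(** Criticality of x cancels the terms of order 0. Between light bodies the mass factor e^3 and the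
    factor e^-2 of the rescaled kernel leave e, which the division removes: that attraction appears
    exactly, without e. *)
Lemma row_zoomed_mapR (e : R) u j : 0 < e -> row (rshift N j) (zoomed_map e u) =
  row (rshift N j) u
  - \sum_(i < N) m 0 i *: (e^-1 *:
      (kern ((x - row i Q) + e *: (row (rshift N j) u + e ^+ 2 *: - row (lshift k i) u))
       - kern (x - row i Q)))
  - \sum_(l < k | l != j) mu 0 l *: kern (row (rshift N j) u - row (rshift N l) u).
Proof.
move=> e0; have e1 : e != 0 by rewrite gt_eqF.
rewrite linearD linearZ /= rowKd row0 scaler0 addr0.
rewrite row_anisoR row_ncc_mapR.
rewrite (eq_bigr _ (fun i _ => congr1 (fun v => m 0 i *: kern v) (zoom_RL e u i j))).
have -> : \sum_(l < k | l != j) (e ^+ 3 *: mu) 0 l *: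
      kern (row (rshift N j) (zoom e u) - row (rshift N l) (zoom e u)) =
    e *: \sum_(l < k | l != j) mu 0 l *: kern (row (rshift N j) u - row (rshift N l) u).
  rewrite scaler_sumr; apply: eq_bigr => l _; rewrite zoom_RR kern_scale// mxE [LHS]scalerA [RHS]scalerA.
  by congr (_ *: _); field; exact: e1.
have xi : x = \sum_(i < N) m 0 i *: kern (x - row i Q).
  by apply/eqP; rewrite -subr_eq0; apply/eqP.
rewrite [LHS]scalerBr scalerA mulVf// scale1r; congr (_ - _).
rewrite row_zoomR {1}xi addrAC -sumrB.
rewrite addrC scalerDr scalerA mulVf// scale1r; congr (_ + _).
rewrite scaler_sumr -sumrN; apply: eq_bigr => l _.
by rewrite -scalerBr scalerA mulrC -scalerA -[RHS]scalerN -[X in _ = _ *: X]scalerN opprB.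
Qed.

End perturbation.

Lemma usubmx_linear (R : realType) (N k q : nat) : linear (@usubmx R N k q).
Proof. by move=> c u v; rewrite linearP. Qed.

(** * The limit system, the branch of solutions and its non-degeneracy *)

Section branch.
Variables (R : realType) (N k : nat) (m : 'rV[R]_N) (Q : 'M[R]_(N, 2)) (x : 'rV[R]_2).
Variables (mu : 'rV[R]_k) (P : 'M[R]_(k, 2)) (S : 'M[R]_(N, 2)).
Hypotheses (m0 : forall i, 0 < m 0 i) (mu0 : forall j, 0 < mu 0 j).
Hypotheses (nd : nondegenerate_ncc m Q) (xQ : forall i, x - row i Q != 0).
Hypotheses (gx : Vres_grad m Q x = 0) (cfP : collision_free P).
Hypothesis (gP : forall j, Wtilde_grad m Q x mu P j = 0).
Hypothesis (hP : forall V, (forall j, Wtilde_hess m Q x mu P V j = 0) -> V = 0).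
(** S is the linear response of the massive bodies to the attraction of the light ones, all placed
    at x. *)
Hypothesis (SE : ncc_der m Q S + gauge Q S *: rotm Q =
  \matrix_i \sum_(j < k) mu 0 j *: kern (row i Q - x)).

Let F0 : ncc_map m Q = 0. Proof. by case: nd => -[]. Qed.
Let cfQ : collision_free Q. Proof. by case: nd => -[]. Qed.

Lemma gauge_top_linear : linear (fun u : 'M[R]_(N + k, 2) => gauge Q (usubmx u)).
Proof. by move=> c u v; rewrite usubmx_linear gauge_linear. Qed.

Lemma gauge_rot_linear (v : 'rV[R]_2) :
  linear (fun u : 'M[R]_(N + k, 2) => gauge Q (usubmx u) *: v).
Proof. by move=> c u w; rewrite gauge_top_linear scalerDl scalerA. Qed.

Lemma rowN_linear (i : 'I_(N + k)) : linear (fun u : 'M[R]_(N + k, 2) => - row i u).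
Proof. by move=> c u v; rewrite row_linear opprD scalerN. Qed.

Let rowsL (i l : 'I_N) := @rowB_linear R (N + k) 2 (lshift k i) (lshift k l).
Let rowsR (j l : 'I_k) := @rowB_linear R (N + k) 2 (rshift N j) (rshift N l).

Let cube_le (e : R) : 0 < e <= 1 -> 0 < e ^+ 3 <= e.
Proof.
by move=> /andP[e0 e1]; rewrite exprn_gt0//= exprS ler_piMr ?exprn_ile1 ?(ltW e0).
Qed.

Let id_le (e : R) : 0 < e <= 1 -> 0 < e <= e.
Proof. by move=> /andP[-> _]; rewrite lexx. Qed.

Let Q_neq i l : l != i -> row i Q - row l Q != 0.
Proof. by rewrite eq_sym; move: i l; apply/collision_freeP. Qed.

Let P_neq j l : l != j -> row j P - row l P != 0.
Proof. by rewrite eq_sym; move: j l; apply/collision_freeP. Qed.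

Let Qx_neq i : row i Q - x != 0.
Proof. by rewrite -opprB oppr_eq0. Qed.

Let u0 := col_mx S P.

Lemma udiff_zoomed_map :
  udiff (zoomed_map m Q x mu) u0 0 (zoomed_der m Q x mu P : 'M[R]_(N + k, 2) -> _).
Proof.
apply: udiff_rows => a; case: (fintype.split_ordP a) => {}a ->.
  have h1 := udiff_linear_mx u0 (@row_linear R (N + k) 2 (lshift k a)).
  have h2 := udiff_sum (P := fun l => l != a) (index_enum 'I_N) (fun l la =>
    udiffZ (m 0 l) (udiff_rescale_quadratic u0 (rowsL a l) (@linear_cst0 _ _ _)
      (sdiff_kern (Q_neq la)) cube_le)).
  have h3 := udiff_sum (P := predT) (index_enum 'I_k) (fun j _ =>
    udiffZ (mu 0 j) (udiff_mule_shift u0 (rowN_linear (rshift N j))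
      (@row_linear R (N + k) 2 (lshift k a)) (sdiff_kern (Qx_neq a)))).
  have h4 := udiff_linear_mx u0 (gauge_rot_linear (rot90 (row a Q))).
  apply: udiff_eq (udiffD (udiffB (udiffB h1 h2) h3) h4) => [e u e0||h].
  - by rewrite row_zoomed_mapL.
  - have U l : row (lshift k l) u0 = row l S := rowKu _ _ _.
    have := congr1 (row a) SE; rewrite linearD linearZ /= row_ncc_der !rowK => E.
    rewrite row0 col_mxKu U.
    rewrite (eq_bigr (fun l => m 0 l *: dkern (row a Q - row l Q) (row a S - row l S))).
      by rewrite addrAC E subrr.
    by move=> l _; rewrite U.
  - have U l : row l (usubmx h) = row (lshift k l) h := row_usubmx _ _.
    have W l : row l (rotm Q) = rot90 (row l Q) := rowK _ _.
    have Z : \sum_(j < k | predT j) mu 0 j *: (0 : 'rV[R]_2) = 0.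
      by rewrite big1// => j _; rewrite scaler0.
    rewrite [RHS]rowKu [RHS](linear_funD (@row_linear _ _ _ _)) row_ncc_der.
    rewrite (linear_funZ (@row_linear R N 2 a) (gauge Q (usubmx h)) (rotm Q)).
    rewrite (W a) (U a) Z subr0.
    rewrite [in RHS](eq_bigr (fun l => m 0 l *:
      dkern (row a Q - row l Q) (row (lshift k a) h - row (lshift k l) h))) //.
    by move=> l _; rewrite U.
have h1 := udiff_linear_mx u0 (@row_linear R (N + k) 2 (rshift N a)).
have h2 := udiff_sum (P := predT) (index_enum 'I_N) (fun i _ =>
  udiffZ (m 0 i) (udiff_rescale_quadratic (rho := id) u0
    (@row_linear R (N + k) 2 (rshift N a)) (rowN_linear (lshift k i))
    (sdiff_kern (xQ i)) id_le)).
have u0R j l : l != j -> row (rshift N j) u0 - row (rshift N l) u0 != 0.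
  by move=> lj; rewrite !rowKd; exact: P_neq.
have h3 := udiff_sum (P := fun l => l != a) (index_enum 'I_k) (fun l la =>
  udiffZ (mu 0 l) (sdiff_comp_linear (rowsR a l) (sdiff_kern (u0R a l la)))).
apply: udiff_eq (udiffB (udiffB h1 h2) h3) => [e u e0||h].
- by rewrite row_zoomed_mapR.
- have U l : row (rshift N l) u0 = row l P := rowKd _ _ _.
  rewrite row0 -[RHS](gP a) U.
  rewrite [X in _ - X](eq_bigr (fun l => mu 0 l *: kern (row a P - row l P))) //.
  by move=> l _; rewrite U.
- have U l : row (rshift N l) u0 = row l P := rowKd _ _ _.
  have V l : row l (dsubmx h) = row (rshift N l) h := row_dsubmx _ _.
  rewrite [RHS]rowKd rowK /Wtilde_hess V.
  rewrite [X in _ - X](eq_bigr (fun l => mu 0 l *: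
    dkern (row a P - row l P) (row a (dsubmx h) - row l (dsubmx h)))).
    by rewrite V.
  by move=> l _; rewrite !U !V.
Qed.

Lemma zoomed_der_inj (h : 'M[R]_(N + k, 2)) : zoomed_der m Q x mu P h = 0 -> h = 0.
Proof.
move=> E; have := congr1 usubmx E; rewrite col_mxKu linear0 => h1.
have := congr1 dsubmx E; rewrite col_mxKd linear0 => h2.
rewrite -[h]vsubmxK (gauged_ncc_der_inj m0 nd h1) (hP (V := dsubmx h)) ?col_mx0// => j.
by have := congr1 (row j) h2; rewrite rowK row0.
Qed.

(** The exact derivative at fixed e: the derivative of the full (N+k)-body map, conjugated by the
    scaling, plus the gauge term. Through this formula injectivity for the rescaled problem yields
    the rank for the original one. *)
Lemma sdiff_zoomed_map (e : R) u : 0 < e -> collision_free (zoom Q x e u) ->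
  sdiff (zoomed_map m Q x mu e) u (fun h : 'M[R]_(N + k, 2) =>
    aniso (e ^+ 3)^-1 e^-1 (ncc_der (masses m mu e) (zoom Q x e u) (aniso (e ^+ 3) e h))
    + gauge Q (usubmx h) *: col_mx (rotm Q) (0 : 'M[R]_(k, 2))).
Proof.
move=> e0 cf.
have z1 := udiffD (udiff_cst u (col_mx Q (\matrix_(j < k) x)))
  (udiff_linear_mx u (@aniso_linear R N k (e ^+ 3) e)).
have f1 := udiff_comp (sdiff_ncc_map (masses m mu e) cf) z1.
have f2 := udiff_comp (udiff_linear_mx (ncc_map (masses m mu e) (zoom Q x e u))
  (@aniso_linear R N k (e ^+ 3)^-1 e^-1)) f1.
have gl : linear (fun u : 'M[R]_(N + k, 2) => gauge Q (usubmx u) *: col_mx (rotm Q) (0 : 'M[R]_(k, 2))).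
  by move=> c v w; rewrite gauge_top_linear scalerDl scalerA.
have h1 := udiffD f2 (udiff_linear_mx u gl).
apply: (udiff_eq _ _ _ h1) => [t v _||h].
- reflexivity.
- reflexivity.
- rewrite (add0r (aniso (e ^+ 3) e h)).
  reflexivity.
Qed.

(* Pairing F = - e^3 gauge(u) J Q with J z and the masses gives 0 by ncc_pairing. *)
Lemma gauge_vanishes (e : R) u : 0 < e ->
  \sum_i m 0 i * dot (row (lshift k i) (zoom Q x e u)) (row i Q) != 0 ->
  zoomed_map m Q x mu e u = 0 -> ncc_map (masses m mu e) (zoom Q x e u) = 0.
Proof.
move=> e0 s0 z0; have e3 : e ^+ 3 != 0 by rewrite expf_neq0// gt_eqF.
set F := ncc_map _ _; set g := gauge Q (usubmx u).
have FL i : row (lshift k i) F = - (e ^+ 3 * g) *: rot90 (row i Q).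
  have := congr1 (row (lshift k i)) z0.
  rewrite linearD linearZ /= rowKu rowK row_anisoL row0 -/F -/g => /(congr1 (fun v => e ^+ 3 *: v)).
  rewrite scaler0 scalerDr !scalerA mulfV// scale1r => /eqP; rewrite addr_eq0 => /eqP ->.
  by rewrite scaleNr.
have FR j : row (rshift N j) F = 0.
  have := congr1 (row (rshift N j)) z0.
  rewrite linearD linearZ /= rowKd !row0 scaler0 addr0 row_anisoR -/F => /eqP.
  by rewrite scaler_eq0 invr_eq0 gt_eqF//= => /eqP.
have := ncc_pairing (masses m mu e) (zoom Q x e u); rewrite big_split_ord /=.
rewrite [X in _ + X]big1 => [|j _]; last by rewrite -/F FR dot0r mulr0.
rewrite (eq_bigr (fun i => - (e ^+ 3 * g) *
    (m 0 i * dot (row (lshift k i) (zoom Q x e u)) (row i Q)))); last first.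
  by move=> i _; rewrite -/F FL dotZr dot_rot2 row_mxEl mulrCA.
rewrite -mulr_sumr addr0 => /eqP; rewrite mulf_eq0 (negbTE s0) orbF oppr_eq0 => /eqP g0.
apply: split_rowP => i; rewrite row0; first by rewrite FL g0 oppr0 scale0r.
exact: FR.
Qed.

End branch.

(** Distances between massive bodies, and from massive to light ones, have positive limits. Those
    between light bodies tend to 0, but divided by e they approach the distances of the light
    configuration. *)
Lemma zoom_collision_free (R : realType) (N k : nat) (Q : 'M[R]_(N, 2)) (x : 'rV[R]_2)
    (u0 : 'M[R]_(N + k, 2)) :
  collision_free Q -> (forall i, x - row i Q != 0) -> collision_free (dsubmx u0) ->
  exists2 r : R, 0 < r & forall (e : R) (u : 'M[R]_(N + k, 2)),
    0 < e <= r -> `|u - u0| <= r -> collision_free (zoom Q x e u).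
Proof.
move=> /collision_freeP cfQ xQ /collision_freeP cfP.
have zl := @linear_cst0 R 'M[R]_(N + k, 2) 'rV[R]_2.
have [r1 r10 h1] := udiff_neq0_fin (P := fun il : 'I_N * 'I_N => il.1 != il.2)
  (fun il _ => udiff_shift u0 (row il.1 Q - row il.2 Q) zl
     (@rowB_linear R (N + k) 2 (lshift k il.1) (lshift k il.2)))
  (fun il => cfQ il.1 il.2).
have [r2 r20 h2] := udiff_neq0_fin (P := fun ij : 'I_N * 'I_k => true)
  (fun ij _ => udiff_shift u0 (x - row ij.1 Q) (@row_linear R (N + k) 2 (rshift N ij.2))
     (@rowN_linear R N k (lshift k ij.1)))
  (fun ij _ => xQ ij.1).
have cfu j l : j != l -> row (rshift N j) u0 - row (rshift N l) u0 != 0.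
  by move=> jl; rewrite -!row_dsubmx; exact: cfP.
have [r3 r30 h3] := udiff_neq0_fin (P := fun jl : 'I_k * 'I_k => jl.1 != jl.2)
  (fun jl _ => udiff_linear_mx u0 (@rowB_linear R (N + k) 2 (rshift N jl.1) (rshift N jl.2)))
  (fun jl => cfu jl.1 jl.2).
exists (Num.min r1 (Num.min r2 r3)); first by rewrite !lt_min r10 r20.
move=> e u /andP[e0]; rewrite !le_min => /and3P[er1 er2 er3] /and3P[ur1 ur2 ur3].
have e1 : 0 < e <= r1 by rewrite e0.
have e2 : 0 < e <= r2 by rewrite e0.
have e3 : 0 < e <= r3 by rewrite e0.
have LR i j : row (rshift N j) (zoom Q x e u) - row (lshift k i) (zoom Q x e u) != 0.
  by rewrite zoom_RL; exact: (h2 e u e2 ur2 (i, j)).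
apply/collision_freeP => i j.
case: (fintype.split_ordP i) => {}i ->; case: (fintype.split_ordP j) => {}j ->.
- rewrite eq_lshift => ij; rewrite zoom_LL scaler0 addr0.
  by have := h1 e u e1 ur1 (i, j) ij; rewrite add0r scalerA -exprS.
- by move=> _; rewrite -opprB oppr_eq0.
- by move=> _.
- rewrite eq_rshift => ij; rewrite zoom_RR scaler_eq0 gt_eqF//=.
  exact: (h3 e u e3 ur3 (i, j) ij).
Qed.

(** The sum tends to the moment of inertia of Q. It is the factor that multiplies the gauge in
    [gauge_vanishes]. *)
Lemma zoom_inertia_neq0 (R : realType) (N k : nat) (m : 'rV[R]_N) (Q : 'M[R]_(N, 2))
    (x : 'rV[R]_2) (u0 : 'M[R]_(N + k, 2)) :
  \sum_i m 0 i * dot (row i Q) (row i Q) != 0 ->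
  exists2 r : R, 0 < r & forall (e : R) (u : 'M[R]_(N + k, 2)),
    0 < e <= r -> `|u - u0| <= r ->
    \sum_i m 0 i * dot (row (lshift k i) (zoom Q x e u)) (row i Q) != 0.
Proof.
move=> s0; have zl := @linear_cst0 R 'M[R]_(N + k, 2) 'rV[R]_2.
have h := udiff_sum (P := predT) (index_enum 'I_N) (fun i _ => udiffZ (m 0 i)
  (udiff_dot (udiff_shift u0 (row i Q) zl (@row_linear R (N + k) 2 (lshift k i)))
             (udiff_cst u0 (row i Q)))).
have [r r0 hr] := udiff_neq0 h s0; exists r => // e u er ur.
have := hr e u er ur; rewrite (eq_bigr (fun i =>
  m 0 i * dot (row (lshift k i) (zoom Q x e u)) (row i Q))) // => i _.
by rewrite row_zoomL add0r scalerA -exprS.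
Qed.

Lemma branch_exists (R : realType) (N k : nat) (m : 'rV[R]_N) (Q : 'M[R]_(N, 2))
    (x : 'rV[R]_2) (mu : 'rV[R]_k) (P : 'M[R]_(k, 2)) :
  (forall i, 0 < m 0 i) -> (forall j, 0 < mu 0 j) -> nondegenerate_ncc m Q ->
  nondegenerate_relative_ncc m Q x -> nondegenerate_cc_of_Wtilde m Q x mu P ->
  exists S (C d : R) (U : R -> 'M[R]_(N + k, 2)), [/\ 0 < C, 0 < d &
    forall e : R, 0 < e <= d -> nondegenerate_ncc (masses m mu e) (zoom Q x e (U e)) /\
      `|U e - col_mx S P| <= C * e].
Proof.
move=> m0 mu0 nd [[xQ' cx] _] [[cfP cP] hessP].
have xQ i : x - row i Q != 0 by rewrite subr_eq0; apply/eqP.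
have gx := critical_point_Vres xQ cx.
have gP := critical_point_Wtilde xQ mu0 cfP cP.
have hP := Wtilde_hess_inj xQ cfP hessP.
have [[cfQ _] _] := nd.
have [S SE] := gauged_ncc_der_surj m0 nd
  (\matrix_i \sum_(j < k) mu 0 j *: kern (row i Q - x)).
have zd := udiff_zoomed_map nd xQ gx cfP gP SE.
have zi := @zoomed_der_inj R N k m Q x mu P m0 nd hP.
have [C [d1 [C0 d10 sol]]] := udiff_zero zd zi.
have [r1 r10 inj] := udiff_derivative_inj zd zi.
have cfu : collision_free (dsubmx (col_mx S P)) by rewrite col_mxKd.
have [r2 r20 cf] := zoom_collision_free cfQ xQ cfu.
have s0 : \sum_i m 0 i * dot (row i Q) (row i Q) != 0.
  by rewrite gt_eqF// (inertia_gt0 m0 nd).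
have [r3 r30 ine] := zoom_inertia_neq0 x (col_mx S P) s0.
pose r : R := Num.min r1 (Num.min r2 r3).
have r0 : 0 < r by rewrite !lt_min r10 r20.
(* The bound e (1 + C) <= r puts both e and the distance C e below r. *)
pose d : R := Num.min d1 (r / (1 + C)).
have C1 : 0 < 1 + C by rewrite addr_gt0.
have d0 : 0 < d by rewrite lt_min d10 divr_gt0.
(* Extended to all e, with an arbitrary value outside the range, so that choice yields a function
   U. *)
have sol' (e : R) : exists u, 0 < e <= d ->
    zoomed_map m Q x mu e u = 0 /\ `|u - col_mx S P| <= C * e.
  have [ed|] := boolP (0 < e <= d); last by exists 0.
  have [|u uz uC] := sol e; last by exists u.
  by case/andP: ed => ->; rewrite le_min => /andP[].
have [U HU] := choice sol'.
exists S, C, d, U; split=> // e ed; have [Uz UC] := HU e ed; split=> //.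
move: (ed) => /andP[e0]; rewrite le_min => /andP[_].
rewrite ler_pdivlMr// mulrDr mulr1 => er.
have er' : e <= r by apply: le_trans er; rewrite lerDl mulr_ge0// ltW.
have Ur : `|U e - col_mx S P| <= r.
  by apply: le_trans UC _; apply: le_trans er; rewrite mulrC lerDr ltW.
move: er' Ur; rewrite !le_min => /and3P[e1 e2 e3] /and3P[u1 u2 u3].
have e01 : 0 < e <= r1 by rewrite e0.
have e02 : 0 < e <= r2 by rewrite e0.
have e03 : 0 < e <= r3 by rewrite e0.
have cfz := cf e (U e) e02 u2.
have se := ine e (U e) e03 u3.
have Fz := gauge_vanishes e0 se Uz.
have z0 : zoom Q x e (U e) != 0.
  apply: contra se => /eqP ->; apply/eqP; rewrite big1// => i _.
  by rewrite row0 dot0l mulr0.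
apply: (nondegenerate_ncc_of_inj (w := col_mx (rotm Q) 0)
  (lam := fun h : 'M[R]_(N + k, 2) => gauge Q (usubmx h))) => //.
  exact: gauge_top_linear.
move=> V VE.
have ee : e != 0 by rewrite gt_eqF.
have e3' : e ^+ 3 != 0 by rewrite expf_neq0.
(* Unknowns and equations of the massive block carry the same factor e^3, so the gauge correction
   keeps its form under the conjugation. *)
suff h0 : aniso (e ^+ 3)^-1 e^-1 V = 0.
  apply: (can_inj (@anisoK R N k (e ^+ 3)^-1 e^-1 _ _)); rewrite ?invr_eq0//.
  by rewrite h0 (linear_fun0 (@aniso_linear R N k _ _)).
apply: (inj e (U e) _ e01 u1 (sdiff_zoomed_map m mu e0 cfz)).
have aK : aniso (e ^+ 3) e (aniso (e ^+ 3)^-1 e^-1 V) = V.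
  by have := @anisoK R N k (e ^+ 3)^-1 e^-1; rewrite !invr_eq0 !invrK; apply.
rewrite aK; move: VE => /(congr1 (aniso (e ^+ 3)^-1 e^-1)).
rewrite (linear_fun0 (@aniso_linear R N k _ _)) (linear_funD (@aniso_linear R N k _ _)).
move=> <-; congr (_ + _); apply: split_rowP => i.
  rewrite row_anisoL (linear_funZ (@row_linear _ _ _ _)) (linear_funZ (@row_linear _ _ _ _)).
  by rewrite /aniso col_mxKu (linear_funZ (@gauge_linear _ _ _)) scalerA.
rewrite row_anisoR (linear_funZ (@row_linear _ _ _ _)) (linear_funZ (@row_linear _ _ _ _)).
by rewrite rowKd row0 !scaler0.
Qed.

Theorem theorem11 (R : realType) (N k : nat)
    (m : 'rV[R]_N) (Qhat : 'M[R]_(N, 2)) (xstar : 'rV[R]_2)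
    (mutilde : 'rV[R]_k) (Phat : 'M[R]_(k, 2))
    (m_gt0 : forall i : 'I_N, 0 < m 0 i)
    (hQ : nondegenerate_ncc m Qhat)
    (hx : nondegenerate_relative_ncc m Qhat xstar)
    (mutilde_gt0 : forall j : 'I_k, 0 < mutilde 0 j)
    (mutilde_sum : \sum_(j < k) mutilde 0 j = 1)
    (hP : nondegenerate_cc_of_Wtilde m Qhat xstar mutilde Phat) :
  exists (Q : R -> 'M[R]_(N, 2)) (P : R -> 'M[R]_(k, 2)),
    [/\ \forall Theta \near (0 : R)^'+,
          nondegenerate_ncc (row_mx m (Theta *: mutilde))
                            (col_mx (Q Theta) (P Theta)),
        forall i : 'I_N,
          (fun Theta : R => row i (Q Theta))
            = (fun=> row i Qhat) +O_ ((0 : R)^'+) (fun Theta : R => Theta)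
      & forall j : 'I_k,
          (fun Theta : R => row j (P Theta))
            = (fun Theta => xstar + (Theta `^ (1 / 3)) *: row j Phat)
            +O_ ((0 : R)^'+) (fun Theta : R => Theta `^ (2 / 3))].
Proof.
have [S [C [d [U [C0 d0 HU]]]]] := branch_exists m_gt0 mutilde_gt0 hQ hx hP.
pose root (T : R) : R := T `^ (1 / 3).
pose Z (T : R) := zoom Qhat xstar (root T) (U (root T)).
have root0 T : 0 < T -> 0 < root T by move=> T0; exact: powR_gt0.
have root3 T : 0 < T -> root T ^+ 3 = T.
  move=> T0; rewrite -powR_mulrn ?powR_ge0// -powRrM mul1r mulVf ?pnatr_eq0//.
  by rewrite powRr1// ltW.
have root2 T : 0 < T -> root T ^+ 2 = T `^ (2 / 3).
  by move=> T0; rewrite -powR_mulrn ?powR_ge0// -powRrM mul1r mulrC.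
have rootd T : 0 < T -> T <= d ^+ 3 -> 0 < root T <= d.
  move=> T0 Td; rewrite root0//=.
  rewrite -(@ler_pXn2r _ 3) ?nnegrE ?(ltW d0) ?(ltW (root0 T T0))//.
  by rewrite root3.
have d3 : 0 < d ^+ 3 by rewrite exprn_gt0.
exists (fun T => usubmx (Z T)), (fun T => dsubmx (Z T)); split.
- near=> T; have T0 : 0 < T by near: T; exact: nbhs_right_gt.
  have Td : T <= d ^+ 3 by near: T; exact: nbhs_right_le.
  rewrite vsubmxK -{1}(root3 T T0).
  by have [] := HU (root T) (rootd T T0 Td).
(* The displacement is e^3 = Theta times a row of U, for which boundedness is enough. *)
- move=> i; apply/eqaddOP; near=> K; near=> T.
  have T0 : 0 < T by near: T; exact: nbhs_right_gt.
  have Td : T <= d ^+ 3 by near: T; exact: nbhs_right_le.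
  have [_ Ue] := HU (root T) (rootd T T0 Td).
  rewrite -[X in `|X|]/(row i (usubmx (Z T)) - row i Qhat) row_usubmx.
  rewrite row_zoomL addrC addKr root3// normrZ mulrC.
  rewrite ler_wpM2r//; apply: le_trans (mx_norm_row _ _) _.
  rewrite -[U _](subrK (col_mx S Phat)); apply: le_trans (ler_normD _ _) _.
  apply: (@le_trans _ _ (C * d + `|col_mx S Phat|)).
    rewrite lerD2r; apply: le_trans Ue _; rewrite ler_wpM2l ?(ltW C0)//.
    by case/andP: (rootd T T0 Td).
  by near: K; apply: nbhs_pinfty_ge; exact: num_real.
(* Here the scale is only e, and the second factor e comes from the distance O(e) of U to its
   limit. *)
- move=> j; apply/eqaddOP; near=> K; near=> T.
  have T0 : 0 < T by near: T; exact: nbhs_right_gt.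
  have Td : T <= d ^+ 3 by near: T; exact: nbhs_right_le.
  have [_ Ue] := HU (root T) (rootd T T0 Td).
  rewrite -[X in `|X|]/(row j (dsubmx (Z T)) - (xstar + root T *: row j Phat)) row_dsubmx.
  rewrite row_zoomR opprD addrACA subrr add0r -scalerBr normrZ.
  rewrite -root2// normrX (gtr0_norm (root0 T T0)).
  rewrite expr2 mulrA [X in _ <= X]mulrC ler_wpM2l ?(ltW (root0 T T0))//.
  have -> : row (rshift N j) (U (root T)) - row j Phat =
      row (rshift N j) (U (root T) - col_mx S Phat).
    by rewrite (linear_funB (@row_linear _ _ _ _)) rowKd.
  apply: le_trans (mx_norm_row _ _) _; apply: le_trans Ue _.
  by rewrite ler_wpM2r ?(ltW (root0 T T0)).
Unshelve. all: by end_near. Qed.
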